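(* Let $D_1^*,D_2^*$ be as defined in the context and $c_i=\frac12\log_2\!\big[\frac{\pi e}{6}\big(\frac{D_i^*}{D_i}+1\big)\big]$, $i=1,2$. For any $(R_1^*,R_2^* )\in\mathcal R^*(D_1^*,D_2^* )$ and any $(R_1,R_2)\in\mathcal R(D_1,D_2)$ with $R_1\in\overline{\mathcal R}_1(D_1,D_2)$ and $R_1+R_2=H(Y_1,Y_2\mid Z_1,Z_2)$, $$R_1+R_2\le R_1^*+R_2^*+c_1+c_2.$$ Moreover, for every $(R_1^*,R_2^* )\in\mathcal R^*(D_1^*,D_2^* )$ with $R_1^*\in\overline{\mathcal R}_1(D_1,D_2)$ there exists $(R_1,R_2)\in\mathcal R(D_1,D_2)$ with $R_1=R_1^*$ and $R_2\le R_2^*+c_1+c_2$.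
   Context: Logarithms base 2. $(X_1,X_2)$ is a memoryless pair of real random variables with joint density supported in $[-A,A]^2$, with $\mathbb E X_1=\mathbb E X_2=0$; $\sigma_i^2=\mathbb E[X_i^2]$, $\rho=\mathbb E[X_1X_2]$; $D_1,D_2>0$. For distortion levels $(d_1,d_2)$, $\mathcal R^*(d_1,d_2)$ is the set of pairs $(R_1^*,R_2^* )$ such that for every $\delta>0$ and all large $n$ there exist encoders $f_i:[-A,A]^n\to\{1,\dots,M_i\}$ and a decoder $g$ producing $(\hat{\mathbf X}_1,\hat{\mathbf X}_2)$ from $(f_1(\mathbf X_1),f_2(\mathbf X_2))$ with $\frac1n\mathbb E\|\mathbf X_i-\hat{\mathbf X}_i\|^2\le d_i+\delta$ and $\frac1n\log M_i\le R_i^*+\delta$. For $i=1,2$: $\mathcal Q_i$ maps $x$ to the nearest point of $2\sqrt{3D_i}\mathbb Z$, $Z_1,Z_2$ are independent of each other and of the source with $Z_i$ uniform on $[-\sqrt{3D_i},\sqrt{3D_i}]$, $Y_i=\mathcal Q_i(X_i+Z_i)$. $\mathcal R(D_1,D_2)$ is the set of $(R_1,R_2)$ with $R_1\ge H(Y_1|Y_2,Z_1,Z_2)$, $R_2\ge H(Y_2|Y_1,Z_1,Z_2)$, $R_1+R_2\ge H(Y_1,Y_2|Z_1,Z_2)$; $\overline{\mathcal R}_1(D_1,D_2)=[H(Y_1|Y_2,Z_1,Z_2),H(Y_1|Z_1)]$. With $|\Lambda|=(\sigma_1^2+D_1)(\sigma_2^2+D_2)-\rho^2$, $D_1^*=D_1\frac{\sigma_1^2(\sigma_2^2+D_2)-\rho^2}{|\Lambda|}$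 and $D_2^*=D_2\frac{\sigma_2^2(\sigma_1^2+D_1)-\rho^2}{|\Lambda|}$; these are the per-letter mean-square errors obtained when the decoder of the dithered scheme (which achieves the rates in $\mathcal R(D_1,D_2)$) outputs the linear MMSE estimate of each $X_i$ from $(Y_1-Z_1,Y_2-Z_2)$. *)

(* Defs.v *)
From HB Require Import structures.
From mathcomp Require Import all_boot all_order all_algebra.
From mathcomp Require Import all_classical all_reals all_analysis.
Set Implicit Arguments. Unset Strict Implicit. Unset Printing Implicit Defensive.
Import Order.TTheory GRing.Theory Num.Theory.
Import numFieldNormedType.Exports.
Local Open Scope classical_set_scope.
Local Open Scope ring_scope.

Section Defs.
Variable R : realType.

Definition log2 (x : R) : R := ln x / ln 2.

Definition leb2 := ((@lebesgue_measure R) \x (@lebesgue_measure R))%E.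

Definition qstep (D : R) : R := 2 * Num.sqrt (3 * D).
Definition quant (D : R) (x : R) : R :=
  qstep D * (Num.floor (x / qstep D + 2^-1))%:~R.

(* joint density f of (X1,X2) *)
Definition second_moment1 (f : R -> R -> R) : R :=
  fine (\int[leb2]_p ((p.1 ^+ 2 * f p.1 p.2)%:E))%E.
Definition second_moment2 (f : R -> R -> R) : R :=
  fine (\int[leb2]_p ((p.2 ^+ 2 * f p.1 p.2)%:E))%E.
Definition correlation (f : R -> R -> R) : R :=
  fine (\int[leb2]_p ((p.1 * p.2 * f p.1 p.2)%:E))%E.

Definition detLambda f D1 D2 : R :=
  (second_moment1 f + D1) * (second_moment2 f + D2) - correlation f ^+ 2.
Definition Dstar1 f D1 D2 : R :=
  D1 * (second_moment1 f * (second_moment2 f + D2) - correlation f ^+ 2)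
  / detLambda f D1 D2.
Definition Dstar2 f D1 D2 : R :=
  D2 * (second_moment2 f * (second_moment1 f + D1) - correlation f ^+ 2)
  / detLambda f D1 D2.

Definition cconst (Dstar D : R) : R :=
  2^-1 * log2 (pi * expR 1 / 6 * (Dstar / D + 1)).

(* For a dither value z = (z1,z2): P(Y1 = y1, Y2 = y2 | Z = z) *)
Definition pY12 f D1 D2 (z : R * R) (y : R * R) : R :=
  fine (\int[leb2]_p ((f p.1 p.2 *
    (quant D1 (p.1 + z.1) == y.1)%:R * (quant D2 (p.2 + z.2) == y.2)%:R)%:E))%E.
Definition pY1 f D1 (z1 : R) (y1 : R) : R :=
  fine (\int[leb2]_p ((f p.1 p.2 * (quant D1 (p.1 + z1) == y1)%:R)%:E))%E.
Definition pY2 f D2 (z2 : R) (y2 : R) : R :=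
  fine (\int[leb2]_p ((f p.1 p.2 * (quant D2 (p.2 + z2) == y2)%:R)%:E))%E.

Definition ditherbox D1 D2 : set (R * R) :=
  `[- (qstep D1 / 2), qstep D1 / 2] `*` `[- (qstep D2 / 2), qstep D2 / 2].
Definition avg_dither2 D1 D2 (g : R * R -> \bar R) : \bar R :=
  (((qstep D1 * qstep D2)^-1)%R%:E * \int[leb2]_(z in ditherbox D1 D2) g z)%E.

Definition H_Y12_Z f D1 D2 : \bar R :=
  avg_dither2 D1 D2 (fun z =>
    \esum_(y in [set: R * R]) (- pY12 f D1 D2 z y * log2 (pY12 f D1 D2 z y))%:E).
Definition H_Y1_Y2Z f D1 D2 : \bar R :=
  avg_dither2 D1 D2 (fun z =>
    \esum_(y in [set: R * R])
      (- pY12 f D1 D2 z y * log2 (pY12 f D1 D2 z y / pY2 f D2 z.2 y.2))%:E).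
Definition H_Y2_Y1Z f D1 D2 : \bar R :=
  avg_dither2 D1 D2 (fun z =>
    \esum_(y in [set: R * R])
      (- pY12 f D1 D2 z y * log2 (pY12 f D1 D2 z y / pY1 f D1 z.1 y.1))%:E).
Definition ditherint D1 : set R := `[- (qstep D1 / 2), qstep D1 / 2].
Definition H_Y1_Z1 f D1 : \bar R :=
  (((qstep D1)^-1)%R%:E *
   \int[@lebesgue_measure R]_(z1 in ditherint D1)
     \esum_(y1 in [set: R]) (- pY1 f D1 z1 y1 * log2 (pY1 f D1 z1 y1))%:E)%E.

Definition inRegion f D1 D2 (R1 R2 : R) : Prop :=
  (H_Y1_Y2Z f D1 D2 <= R1%:E)%E /\ (H_Y2_Y1Z f D1 D2 <= R2%:E)%E /\
  (H_Y12_Z f D1 D2 <= (R1 + R2)%:E)%E.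
Definition inRbar1 f D1 D2 (R1 : R) : Prop :=
  (H_Y1_Y2Z f D1 D2 <= R1%:E)%E /\ (R1%:E <= H_Y1_Z1 f D1)%E.

Definition tuple_boxes n : set (set (n.-tuple R)) :=
  [set S | exists B : 'I_n -> set R, (forall i, measurable (B i)) /\
           S = [set t | forall i, B i (tnth t i)]].
Definition tuple_measurable n (S : set (n.-tuple R)) : Prop :=
  <<s @tuple_boxes n >> S.

(* expectation of h(X1^n, X2^n) for a memoryless source with joint density f *)
Fixpoint blockE (f : R -> R -> R) (n : nat) :
    (n.-tuple R -> n.-tuple R -> \bar R) -> \bar R :=
  match n return (n.-tuple R -> n.-tuple R -> \bar R) -> \bar R with
  | 0 => fun h => h [tuple] [tuple]
  | m.+1 => fun h =>
      (\int[leb2]_p ((f p.1 p.2)%:E *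
          blockE f (fun s t => h [tuple of p.1 :: s] [tuple of p.2 :: t])))%E
  end.

Definition sqdist n (x y : n.-tuple R) : R :=
  \sum_(i < n) (tnth x i - tnth y i) ^+ 2.

Definition in_opregion f (d1 d2 Rs1 Rs2 : R) : Prop :=
  forall delta : R, 0 < delta -> exists N : nat, forall n : nat, (N <= n)%N ->
  exists (M1 M2 : nat)
         (enc1 : n.-tuple R -> 'I_M1) (enc2 : n.-tuple R -> 'I_M2)
         (dec : 'I_M1 -> 'I_M2 -> n.-tuple R * n.-tuple R),
    (forall m, tuple_measurable (enc1 @^-1` [set m])) /\
    (forall m, tuple_measurable (enc2 @^-1` [set m])) /\
    ((n%:R^-1)%:E * blockE f (fun x1 x2 =>
        (sqdist x1 (dec (enc1 x1) (enc2 x2)).1)%:E) <= (d1 + delta)%:E)%E /\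
    ((n%:R^-1)%:E * blockE f (fun x1 x2 =>
        (sqdist x2 (dec (enc1 x1) (enc2 x2)).2)%:E) <= (d2 + delta)%:E)%E /\
    n%:R^-1 * log2 M1%:R <= Rs1 + delta /\
    n%:R^-1 * log2 M2%:R <= Rs2 + delta.

End Defs.

(* Main.v *)
Require Import Defs.
From HB Require Import structures.
From mathcomp Require Import all_boot all_order all_algebra.
From mathcomp Require Import all_classical all_reals all_analysis.
From mathcomp Require Import measurable_realfun ring lra.
Set Implicit Arguments. Unset Strict Implicit. Unset Printing Implicit Defensive.
Import Order.TTheory GRing.Theory Num.Theory.
Import numFieldNormedType.Exports.
Local Open Scope classical_set_scope.
Local Open Scope ring_scope.

(** Everything follows from the sum-rate bound [H(Y1,Y2|Z1,Z2) <= R1* + R2* + c1 + c2]: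
    the second claim takes [R2 := R2* + c1 + c2] and uses the chain rule
    [H(Y1,Y2|Z) = H(Y1|Z1) + H(Y2|Y1,Z)].

    Let [U(x,z)] be the pair of quantizer outputs for the source letter [x] and
    dither [z], [p_z] the law of [Y] given [z], and
    [k(x) = E_Z[-ln p_Z(U(x,Z))]], so that [E k(X) = ln 2 * H(Y1,Y2|Z1,Z2)].
    With [w] the area of the dither box and [phi] the Gaussian density of
    variances [s_i = d_i + D_i], put
    [psi_a(x) = k(x) + E_Z[ln (w * phi(U(x,Z) - Z - a))]].
    Jensen's inequality over the dither, Fubini, and the fact that the cells
    [y - z], for [y] in the lattice and [z] in the box, tile the plane give
    [E exp(psi_a(X)) <= 1] for every reproduction letter [a], while
    [E_Z (U_i(x,Z) - Z_i - a_i)^2 = (x_i - a_i)^2 + D_i].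
    For a code with [M] codewords the product of the [exp(psi_a(x_k))] along the
    transmitted codeword is at most the sum over all codewords of such products,
    whose expectation is at most [M]; since [1 + x <= exp x], this gives
    [n * E k(X) <= ln M + n * (Gaussian cost at the allowed distortion)], and
    the Gaussian cost is [ln 2 * (c1 + c2)].

    The logarithms are smoothed to [ln (p_z + e)] so that [k] is bounded; the
    error is linear in [e], which tends to [0] together with the slack of the code. *)

(** * Expectations over a memoryless block *)

(** A box is a finite intersection of preimages of coordinate maps. This carries the encoder cells
    of [in_opregion] into the product measurable structure on tuples. *)
Lemma tuple_measurable_sub (R : realType) n (S : set (n.-tuple R)) :
  tuple_measurable S -> measurable S.
Proof.
apply: smallest_sub; first exact: sigma_algebra_measurable.
move=> _ [B [mB ->]].
rewrite (_ : [set t | _] = \bigcap_(i in [set: 'I_n]) ((@tnth n R)^~ i @^-1` B i)).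
  apply: fin_bigcap_measurable => //.
  by move=> i _; rewrite -[X in measurable X]setTI; exact: measurable_tnth.
by apply/seteqP; split => [t h i _|t h i]; [exact: h|exact: (h i I)].
Qed.

(** With its measure structure and sigma-finiteness, [leb2] can be used directly in the integration
    and Fubini-Tonelli lemmas. *)
HB.instance Definition _ (R : realType) := Measure.copy (@leb2 R)
  ((@lebesgue_measure R) \x (@lebesgue_measure R))%E.

Lemma sigma_finite_leb2 (R : realType) : sigma_finite setT (@leb2 R).
Proof.
pose I (n : nat) := `[- n%:R, n%:R]%classic : set R.
exists (fun n => I n `*` I n).
  apply/esym; rewrite -subTset => -[a b] _.
  exists (Num.truncn (Num.max `|a| `|b|)).+1 => //=.
  have h := ltW (truncnS_gt (Num.max `|a| `|b|)).
  split; rewrite /I/= in_itv/= -ler_norml; apply: le_trans h;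
    by rewrite le_max lexx ?orbT.
move=> n; split; first by apply: measurableX; exact: measurable_itv.
rewrite /leb2 product_measure1E; [|exact: measurable_itv..].
have hI : (@lebesgue_measure R (I n) < +oo)%E.
  rewrite lebesgue_measure_itv/=; by case: ifP => _; rewrite ?ltry.
apply: lte_mul_pinfty => //; by rewrite ge0_fin_numE.
Qed.

HB.instance Definition _ (R : realType) :=
  Measure_isSigmaFinite.Build _ _ _ (@leb2 R) (@sigma_finite_leb2 R).

Section block_expectation.
Variables (R : realType) (f : R -> R -> R).
Hypothesis f_ge0 : forall a b, 0 <= f a b.
Hypothesis f_meas : measurable_fun [set: R * R] (fun p : R * R => f p.1 p.2).
Hypothesis f_int1 : (\int[@leb2 R]_p (f p.1 p.2)%:E = 1)%E.

Local Open Scope ereal_scope.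
Local Notation TT n := ((n.-tuple R * n.-tuple R)%type : measurableType _).
Local Notation RR := ((R * R)%type : measurableType _).

Lemma measurable_int_leb2 d (W : measurableType d) (H : W * RR -> \bar R) :
  measurable_fun setT H -> (forall u, 0 <= H u) ->
  measurable_fun setT (fun w => \int[@leb2 R]_p H (w, p)).
Proof.
by move=> mH H0; exact: (@measurable_fun_fubini_tonelli_F _ _ _ _ R (@leb2 R) H mH H0).
Qed.

Lemma measurable_densM d (W : measurableType d) (H : W * RR -> \bar R) :
  measurable_fun setT H ->
  measurable_fun setT (fun u => (f u.2.1 u.2.2)%:E * H u).
Proof.
move=> mH; apply: emeasurable_funM => //; apply/measurable_EFinP.
exact: (measurableT_comp f_meas measurable_snd).
Qed.

Lemma blockE_ge0 n (h : n.-tuple R -> n.-tuple R -> \bar R) :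
  (forall s t, 0 <= h s t) -> 0 <= blockE f h.
Proof.
elim: n h => [|n IH] h h0 /=; first exact: h0.
by apply: integral_ge0 => p _; apply: mule_ge0; [rewrite lee_fin|exact: IH].
Qed.

(** The parameter space is general because the induction enlarges it: each step moves the first
    letter pair of the block into the parameter, from [W] to [W * RR]. *)
Lemma measurable_blockE n d (W : measurableType d)
    (H : W -> n.-tuple R -> n.-tuple R -> \bar R) :
  (forall w s t, 0 <= H w s t) ->
  measurable_fun setT
    (fun u : W * TT n => H u.1 u.2.1 u.2.2) ->
  measurable_fun setT (fun w => blockE f (H w)).
Proof.
elim: n d W H => [|n IH] d W H H0 mH /=.
  have m0 : measurable_fun setT
      (fun w : W => (w, (([tuple], [tuple]) : TT 0))) by exact: measurable_fun_pair.
  exact: (measurableT_comp mH m0).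
apply: (measurable_int_leb2 (H := fun u : W * RR => (f u.2.1 u.2.2)%:E *
     blockE f (fun s t => H u.1 [tuple of u.2.1 :: s] [tuple of u.2.2 :: t]))).
  apply: measurable_densM.
  apply: (IH _ _ (fun (u : W * RR) s t =>
     H u.1 [tuple of u.2.1 :: s] [tuple of u.2.2 :: t])) => //.
  apply: (measurableT_comp mH (g := fun u : (W * RR) * (TT n) =>
    (u.1.1, ([tuple of u.1.2.1 :: u.2.1], [tuple of u.1.2.2 :: u.2.2])))).
  apply: measurable_fun_pair; first exact: measurableT_comp.
  apply: measurable_fun_pair.
    apply: (measurable_cons (f := fun u : (W * RR) * (TT n) => u.1.2.1) (g := fun u => u.2.1)).
      by do 2 (apply: measurableT_comp => //).
    exact: measurableT_comp.
  apply: (measurable_cons (f := fun u : (W * RR) * (TT n) => u.1.2.2) (g := fun u => u.2.2)).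
    by do 2 (apply: measurableT_comp => //).
  exact: measurableT_comp.
by move=> u; apply: mule_ge0; [rewrite lee_fin|exact: blockE_ge0].
Qed.

Definition block_measurable n (h : n.-tuple R -> n.-tuple R -> \bar R) :=
  measurable_fun setT (fun u : TT n => h u.1 u.2).

Lemma measurable_consTT n :
  measurable_fun setT (fun u : RR * TT n =>
    ([tuple of u.1.1 :: u.2.1], [tuple of u.1.2 :: u.2.2]) : TT n.+1).
Proof.
apply: measurable_fun_pair.
  apply: (measurable_cons (f := fun u : RR * TT n => u.1.1) (g := fun u => u.2.1));
  exact: measurableT_comp.
apply: (measurable_cons (f := fun u : RR * TT n => u.1.2) (g := fun u => u.2.2));
exact: measurableT_comp.
Qed.

Lemma block_measurable_cons n (h : n.+1.-tuple R -> n.+1.-tuple R -> \bar R) (p : RR) :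
  block_measurable h ->
  block_measurable (fun s t => h [tuple of p.1 :: s] [tuple of p.2 :: t]).
Proof.
move=> mh; have m2 := measurableT_comp mh (@measurable_consTT n).
have m1 : measurable_fun setT (fun u : TT n => (p, u)) by exact: measurable_fun_pair.
exact: (measurableT_comp m2 m1).
Qed.

Lemma measurable_blockE_cons n (h : n.+1.-tuple R -> n.+1.-tuple R -> \bar R) :
  (forall s t, 0 <= h s t) -> block_measurable h ->
  measurable_fun setT (fun p : RR =>
    blockE f (fun s t => h [tuple of p.1 :: s] [tuple of p.2 :: t])).
Proof.
move=> h0 mh; apply: measurable_blockE => //.
exact: (measurableT_comp mh (@measurable_consTT n)).
Qed.

Lemma measurable_densM1 (g : RR -> \bar R) : measurable_fun setT g ->
  measurable_fun setT (fun p : RR => (f p.1 p.2)%:E * g p).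
Proof. by move=> mg; apply: emeasurable_funM => //; exact/measurable_EFinP. Qed.

Lemma blockE_le n (h k : n.-tuple R -> n.-tuple R -> \bar R) :
  (forall s t, 0 <= h s t) -> block_measurable h -> block_measurable k ->
  (forall s t, h s t <= k s t) ->
  blockE f h <= blockE f k.
Proof.
elim: n h k => [|n IH] h k h0 mh mk hk /=; first exact: hk.
have k0 s t : 0 <= k s t by apply: le_trans (hk s t).
apply: ge0_le_integral => //.
- by move=> p _; apply: mule_ge0; [rewrite lee_fin|exact: blockE_ge0].
- by apply: measurable_densM1; exact: measurable_blockE_cons.
- by apply: measurable_densM1; exact: measurable_blockE_cons.
- move=> p _; apply: lee_wpmul2l; first by rewrite lee_fin.
  by apply: IH => //; exact: block_measurable_cons.
Qed.

Lemma blockED n (h k : n.-tuple R -> n.-tuple R -> \bar R) :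
  (forall s t, 0 <= h s t) -> (forall s t, 0 <= k s t) ->
  block_measurable h -> block_measurable k ->
  blockE f (fun s t => h s t + k s t) = blockE f h + blockE f k.
Proof.
elim: n h k => [|n IH] h k h0 k0 mh mk //=.
under eq_integral => p _.
  rewrite IH//; [|exact: block_measurable_cons..].
  rewrite muleDr ?ge0_adde_def// ?inE; [|exact: blockE_ge0..].
  over.
rewrite ge0_integralD//.
- by move=> p _; apply: mule_ge0; [rewrite lee_fin|exact: blockE_ge0].
- by apply: measurable_densM1; exact: measurable_blockE_cons.
- by move=> p _; apply: mule_ge0; [rewrite lee_fin|exact: blockE_ge0].
- by apply: measurable_densM1; exact: measurable_blockE_cons.
Qed.

Lemma blockEZ n c (h : n.-tuple R -> n.-tuple R -> \bar R) : (0 <= c)%R ->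
  (forall s t, 0 <= h s t) -> block_measurable h ->
  blockE f (fun s t => c%:E * h s t) = c%:E * blockE f h.
Proof.
move=> c0; elim: n h => [|n IH] h h0 mh //=.
under eq_integral => p _.
  rewrite IH//; [|exact: block_measurable_cons].
  rewrite muleCA; over.
rewrite ge0_integralZl ?lee_fin//.
- by apply: measurable_densM1; exact: measurable_blockE_cons.
- by move=> p _; apply: mule_ge0; [rewrite lee_fin|exact: blockE_ge0].
Qed.

Lemma blockE_cst n c : (0 <= c)%R ->
  blockE f (fun _ _ : n.-tuple R => c%:E) = c%:E.
Proof.
move=> c0; elim: n => [|n IH] //=.
under eq_integral => p _ do rewrite IH.
rewrite ge0_integralZr ?lee_fin//; first by rewrite f_int1 mul1e.
- exact/measurable_EFinP.
- by move=> p _; rewrite lee_fin.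
Qed.

Lemma block_measurable_cst n c : block_measurable (fun _ _ : n.-tuple R => c).
Proof. exact: measurable_cst. Qed.

Lemma block_measurableD n (h k : n.-tuple R -> n.-tuple R -> \bar R) :
  block_measurable h -> block_measurable k -> block_measurable (fun s t => h s t + k s t).
Proof. exact: emeasurable_funD. Qed.

Lemma block_measurableZ n c (h : n.-tuple R -> n.-tuple R -> \bar R) :
  block_measurable h -> block_measurable (fun s t => c * h s t).
Proof. by move=> mh; apply: emeasurable_funM => //; exact: measurable_cst. Qed.

Lemma block_measurable_sum n (I : Type) (r : seq I)
    (h : I -> n.-tuple R -> n.-tuple R -> \bar R) :
  (forall i, block_measurable (h i)) -> block_measurable (fun s t => \sum_(i <- r) h i s t).
Proof. by move=> mh; apply: emeasurable_sum => i; exact: mh. Qed.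

Lemma blockE_sum n (I : Type) (r : seq I) (h : I -> n.-tuple R -> n.-tuple R -> \bar R) :
  (forall i s t, 0 <= h i s t) -> (forall i, block_measurable (h i)) ->
  blockE f (fun s t => \sum_(i <- r) h i s t) = \sum_(i <- r) blockE f (h i).
Proof.
move=> h0 mh; elim: r => [|i r IH].
  rewrite big_nil -[RHS](@blockE_cst n 0%R)//; congr (blockE f _).
  by apply/funext => s; apply/funext => t; rewrite big_nil.
rewrite big_cons -IH -blockED//; last 2 first.
- by move=> s t; exact: sume_ge0.
- exact: block_measurable_sum.
by congr (blockE f _); apply/funext => s; apply/funext => t; rewrite big_cons.
Qed.

(** Memorylessness: one letter is integrated out at a time, each contributing a factor at most 1.
    The factor depends on the position [i] because the letters of a codeword do. *)
Lemma blockE_prod_le1 n (g : 'I_n -> RR -> R) :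
  (forall i p, (0 <= g i p)%R) -> (forall i, measurable_fun setT (g i)) ->
  (forall i, \int[@leb2 R]_p ((f p.1 p.2)%:E * (g i p)%:E) <= 1) ->
  blockE f (fun s t => (\prod_(i < n) g i (tnth s i, tnth t i))%:E) <= 1.
Proof.
elim: n g => [|n IH] g g0 mg g1 /=; first by rewrite big_ord0.
have eqE p : (f p.1 p.2)%:E * blockE f (fun s t : n.-tuple R =>
    (\prod_(i < n.+1) g i (tnth [tuple of p.1 :: s] i, tnth [tuple of p.2 :: t] i))%:E)
  <= (f p.1 p.2)%:E * (g ord0 p)%:E.
  apply: lee_wpmul2l; first by rewrite lee_fin.
  have mP : block_measurable (fun s t : n.-tuple R =>
    (\prod_(i < n) g (lift ord0 i) (tnth s i, tnth t i))%:E).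
    apply/measurable_EFinP; apply: measurable_prod => i _.
    apply: (measurableT_comp (mg (lift ord0 i))).
    by apply: measurable_fun_pair; apply: (measurableT_comp (measurable_tnth i)).
  rewrite (_ : (fun s t => _) = fun s t => (g ord0 p)%:E *
    (\prod_(i < n) g (lift ord0 i) (tnth s i, tnth t i))%:E); last first.
    apply/funext => s; apply/funext => t; rewrite big_ord_recl/= -EFinM.
    rewrite !tnth0 -surjective_pairing; congr (_ * _)%:E.
    by apply: eq_bigr => i _; rewrite !tnthS.
  rewrite blockEZ//; last by move=> s t; rewrite lee_fin; exact: prodr_ge0.
  rewrite -[leRHS]mule1; apply: lee_wpmul2l; first by rewrite lee_fin.
  by apply: (IH (fun i => g (lift ord0 i))) => // i; exact: g1.
apply: le_trans (g1 ord0); apply: ge0_le_integral => //.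
- move=> p _; apply: mule_ge0; first by rewrite lee_fin.
  by apply: blockE_ge0 => s t; rewrite lee_fin; exact: prodr_ge0.
- apply: measurable_densM1; apply: (measurable_blockE_cons (h := fun s t =>
    (\prod_(i < n.+1) g i (tnth s i, tnth t i))%:E)).
    by move=> s t; rewrite lee_fin; exact: prodr_ge0.
  apply/measurable_EFinP; apply: measurable_prod => i _.
  apply: (measurableT_comp (mg i)).
  by apply: measurable_fun_pair; apply: (measurableT_comp (measurable_tnth i)).
- by apply: measurable_densM1; exact/measurable_EFinP.
Qed.

(** All letters other than the [i]-th integrate to 1, so every position has the single-letter
    law. *)
Lemma blockE_letter n (g : RR -> R) (i : 'I_n) :
  (forall p, (0 <= g p)%R) -> measurable_fun setT g ->
  blockE f (fun s t => (g (tnth s i, tnth t i))%:E) =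
  \int[@leb2 R]_p ((f p.1 p.2)%:E * (g p)%:E).
Proof.
move=> g0 mg; elim: n i => [[]//|n IH] i /=.
case: (unliftP ord0 i) => [j ->|->].
  under eq_integral => p _.
    rewrite (_ : (fun s t => _) = fun s t : n.-tuple R =>
      (g (tnth s j, tnth t j))%:E); last first.
      by apply/funext => s; apply/funext => t; rewrite !tnthS.
    rewrite IH; over.
  rewrite ge0_integralZr//; first by rewrite f_int1 mul1e.
  - exact/measurable_EFinP.
  - by move=> p _; rewrite lee_fin.
  - by apply: integral_ge0 => p _; rewrite mule_ge0 ?lee_fin.
apply: eq_integral => p _; congr (_ * _).
rewrite (_ : (fun s t => _) = fun s t : n.-tuple R => (g p)%:E) ?blockE_cst//.
by apply/funext => s; apply/funext => t; rewrite !tnth0 -surjective_pairing.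
Qed.

End block_expectation.

(** * Integrals over intervals and the scalar quantizer *)

Section interval_integrals.
Variable R : realType.
Local Notation mu := (@lebesgue_measure R).

Lemma integral_reflect (g : R -> R) (c a b : R) : a <= b -> continuous g ->
  (\int[mu]_(z in `[a, b]) (g (c - z))%:E =
   \int[mu]_(u in `[(c - b)%R, (c - a)%R]) (g u)%:E)%E.
Proof.
move=> ab cg; pose F (z : R) := c - z.
have dF (x : R) : is_derive x 1 F (- 1).
  by apply: is_derive_eq; ring.
have F'E : derive1 F = cst (-1).
  by apply/funext => z; rewrite derive1E derive_val.
rewrite (@integration_by_substitution_decreasing R F g a b ab).
- apply: eq_integral => z _; congr (EFin _).
  by rewrite /= F'E /= opprK mulr1.
- by move=> x y _ _; rewrite /F ltrD2l ltrN2.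
- by rewrite F'E => x _; exact: cvg_cst.
- by rewrite F'E; exact: is_cvg_cst.
- by rewrite F'E; exact: is_cvg_cst.
- have cF : continuous F.
    by move=> x; apply: differentiable_continuous; exact/derivable1_diffP.
  by split => [x _||]; [exact: ex_derive|apply: cvg_at_right_filter; exact: cF|
    apply: cvg_at_left_filter; exact: cF].
- exact: continuous_subspaceT.
Qed.

Lemma integral_sqr (c a b : R) : a <= b ->
  (\int[mu]_(z in `[a, b]) ((c - z) ^+ 2)%:E =
   (3^-1 * ((c - a) ^+ 3 - (c - b) ^+ 3))%:E)%E.
Proof.
rewrite le_eqVlt => /predU1P[<-|ab].
  by rewrite set_itv1 integral_set1 subrr mulr0.
pose F (z : R) := - 3^-1 * (c - z) ^+ 3.
have dF (x : R) : is_derive x 1 F ((c - x) ^+ 2).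
  by apply: is_derive_eq; rewrite /GRing.scale/=; field.
have cF : continuous F.
  by move=> x; apply: differentiable_continuous; exact/derivable1_diffP.
rewrite (@continuous_FTC2 R (fun z => (c - z) ^+ 2) F)//.
- by rewrite -EFinB /F; congr EFin; ring.
- apply: continuous_subspaceT => x.
  apply: differentiable_continuous; exact/derivable1_diffP.
- by split => [x _||]; [exact: ex_derive|apply: cvg_at_right_filter; exact: cF|
    apply: cvg_at_left_filter; exact: cF].
- by move=> x _; rewrite derive1E derive_val.
Qed.

(** The closed intervals meet only at endpoints, which are null, so the sum is the integral over
    their union. They are kept closed because they arise by reflecting the closed dither
    interval. *)
Lemma integral_consecutive (g : R -> R) (a e : R) (n : nat) : 0 <= e ->
  measurable_fun setT g -> (forall x, 0 <= g x) ->
  (\sum_(j < n) \int[mu]_(u in `[(a + j%:R * e)%R, (a + j.+1%:R * e)%R]) (g u)%:E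
   <= \int[mu]_u (g u)%:E)%E.
Proof.
move=> e0 mg g0.
have mg' (A : set R) : measurable_fun A (EFin \o g).
  by apply/measurable_EFinP; exact: measurable_funTS.
suff -> : (\sum_(j < n) \int[mu]_(u in `[(a + j%:R * e)%R, (a + j.+1%:R * e)%R]) (g u)%:E
    = \int[mu]_(u in `[a, (a + n%:R * e)%R[) (g u)%:E)%E.
  by apply: ge0_subset_integral => //; [exact: mg'|move=> x _; rewrite lee_fin].
elim: n => [|n IH]; first by rewrite big_ord0 mul0r addr0 set_itvco0 integral_set0.
rewrite big_ord_recr/= IH -[X in (_ + X)%E]integral_itv_bndo_bndc//.
rewrite -ge0_integral_setU//=.
- congr (integral _ _ _); rewrite -itv_bndbnd_setU// bnd_simp.
    by rewrite lerDl mulr_ge0.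
  by rewrite lerD2l ler_wpM2r// ler_nat.
- exact: mg'.
- by move=> x _; rewrite lee_fin.
- apply/disj_setPRL => x /=; rewrite !in_itv/= => /andP[h _].
  by apply/negP; rewrite negb_and -leNgt h orbT.
Qed.

End interval_integrals.

(** * The dithered scalar quantizer: mean-square error and tiling of the line by its cells *)

Section quantizer.
Variable R : realType.
Implicit Types D x a z s : R.
Local Notation mu := (@lebesgue_measure R).

Lemma qstep_gt0 D : 0 < D -> 0 < qstep D.
Proof. by move=> D0; rewrite /qstep mulr_gt0// sqrtr_gt0 mulr_gt0. Qed.

Lemma qstep_sqr D : 0 < D -> qstep D ^+ 2 = 12 * D.
Proof.
by move=> D0; rewrite /qstep exprMn sqr_sqrtr ?mulr_ge0 ?(ltW D0)//; ring.
Qed.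

Lemma measurable_quant D : 0 < D -> measurable_fun setT (quant D).
Proof.
move=> D0; apply: nondecreasing_measurable => //= x y xy.
have q0 := qstep_gt0 D0.
rewrite /quant ler_pM2l// ler_int; apply: le_floor.
by rewrite lerD2r ler_pM2r// invr_gt0.
Qed.

Lemma quantE D x (k : int) : 0 < D ->
  qstep D * k%:~R <= x + qstep D / 2 < qstep D * (k + 1)%:~R -> quant D x = qstep D * k%:~R.
Proof.
move=> D0 /andP[h1 h2]; have q0 := qstep_gt0 D0.
rewrite /quant; congr (_ * _%:~R); apply: floor_def.
rewrite -(ler_pM2l q0) -(ltr_pM2l q0).
rewrite (_ : qstep D * (x / qstep D + 2^-1) = x + qstep D / 2) ?h1//.
by rewrite mulrDr mulrCA divff ?mulr1// gt_eqF.
Qed.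

(** As [z] runs over one period, [quant D (x + z) - z] sweeps an interval of length [qstep D]
    centred at [x]. Averaging the square adds the variance [qstep D ^+ 2 / 12 = D] of a uniform
    variable. *)
Lemma dither_sqr D x a : 0 < D ->
  (\int[mu]_(z in ditherint D) ((quant D (x + z) - z - a) ^+ 2)%:E =
   (qstep D * ((x - a) ^+ 2 + D))%:E)%E.
Proof.
move=> D0; have q0 := qstep_gt0 D0.
set d := qstep D in q0 *; pose k := Num.floor (x / d); pose r := x - d * k%:~R.
have /andP[k1 k2] := floor_itv (x / d).
have r0 : 0 <= r by rewrite /r subr_ge0 mulrC -ler_pdivlMr.
have rd : r < d.
  rewrite /r ltrBlDr -[X in X + _]mulr1 -mulrDr mulrC -ltr_pdivrMr//.
  by move: k2; rewrite intrD addrC.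
have xE : x = d * k%:~R + r by rewrite /r addrC subrK.
have mq (A : set R) : measurable_fun A (fun z : R => ((quant D (x + z) - z - a) ^+ 2)%:E).
  apply: measurable_funTS; apply/measurable_EFinP; apply: measurable_funX.
  apply: measurable_funB => //; apply: measurable_funB => //.
  by apply: measurableT_comp; [exact: measurable_quant|exact: measurable_funD].
(* With [r] the offset of [x] above the lattice point [d * k], the output jumps from [d * k] to
   [d * (k + 1)] exactly at [z = d / 2 - r]. *)
have -> : ditherint D = `[- (d / 2), d / 2 - r[ `|` `[d / 2 - r, d / 2].
  by rewrite /ditherint -itv_bndbnd_setU// bnd_simp; lra.
rewrite ge0_integral_setU//=; last 3 first.
- exact: mq.
- by move=> z _; rewrite lee_fin sqr_ge0.
- apply/disj_setPRL => z /=; rewrite !in_itv/= => /andP[h _].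
  by apply/negP; rewrite negb_and -leNgt h orbT.
under eq_integral.
  move=> z; rewrite inE/= in_itv/= => /andP[h1 h2].
  rewrite (@quantE _ _ k)//; last first.
    by rewrite -/d intrD mulrDr mulr1 xE; apply/andP; split; lra.
  rewrite -/d (_ : _ - z - a = (d * k%:~R - a) - z); last by ring.
  over.
under [X in (_ + X)%E]eq_integral.
  move=> z; rewrite inE/= in_itv/= => /andP[h1 h2].
  rewrite (@quantE _ _ (k + 1))//; last first.
    by rewrite -/d !intrD !mulrDr !mulr1 xE; apply/andP; split; lra.
  rewrite -/d (_ : _ - z - a = (d * (k + 1)%:~R - a) - z); last by ring.
  over.
rewrite integral_itv_bndo_bndc; last first.
  apply/measurable_EFinP; apply: measurable_funTS; apply: measurable_funX.
  exact: measurable_funB.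
rewrite !integral_sqr ?gerBl//; last by lra.
rewrite -EFinD; congr EFin.
have densE : D = d ^+ 2 / 12 by rewrite /d qstep_sqr//; field.
by rewrite [in RHS]densE xE intrD; field.
Qed.

(** The centred normal density of variance [s], with its normalizing constant moved into the
    exponent so that products of densities become sums of exponents. *)
Definition gauss s (t : R) : R := expR (- (2^-1 * ln (2 * pi * s) + t ^+ 2 / (2 * s))).

Lemma gaussE s : 0 < s -> gauss s = normal_pdf 0 (Num.sqrt s).
Proof.
move=> s0; have p0 := pi_gt0 R; have ss0 : Num.sqrt s != 0 by rewrite gt_eqF// sqrtr_gt0.
have e0 : 0 < 2 * pi * s by rewrite !mulr_gt0.
apply/funext => t; rewrite normal_pdfE// /normal_peak /normal_fun sqr_sqrtr ?ltW//.
rewrite subr0 /gauss opprD expRD; congr (_ * _).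
  rewrite expRN; congr (_^-1).
  rewrite (_ : s * pi *+ 2 = 2 * pi * s); last by rewrite -mulr_natl; ring.
  rewrite -[RHS]lnK ?posrE ?sqrtr_gt0//; congr expR.
  rewrite (_ : ln (2 * pi * s) = 2 * ln (Num.sqrt (2 * pi * s))); last first.
    by rewrite [RHS]mulr_natl -lnXn ?sqrtr_gt0// sqr_sqrtr// ltW.
  by rewrite mulrA mulVf ?mul1r.
by rewrite mulNr -[s *+ 2]mulr_natl.
Qed.

Lemma gauss_ge0 s t : 0 <= gauss s t. Proof. exact: expR_ge0. Qed.

Lemma measurable_gauss s : measurable_fun setT (gauss s).
Proof.
apply: measurableT_comp => //; apply: measurable_funN.
by apply: measurable_funD => //; apply: measurable_funM => //; exact: measurable_funX.
Qed.

Lemma integral_gauss s : 0 < s -> (\int[mu]_t (gauss s t)%:E = 1)%E.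
Proof. by move=> s0; rewrite gaussE// integral_normal_pdf// gt_eqF// sqrtr_gt0. Qed.

(** The lattice points with indices from [-K] to [K], as an explicit list: sums over quantizer
    outputs become finite. *)
Definition grid D (K : nat) : seq R :=
  [seq qstep D * (j%:R - K%:R) | j <- iota 0 K.*2.+1].

Lemma grid_uniq D K : 0 < D -> uniq (grid D K).
Proof.
move=> D0; rewrite map_inj_uniq ?iota_uniq// => i j.
move/mulfI => /(_ (lt0r_neq0 (qstep_gt0 D0))) /addIr /eqP.
by rewrite eqr_nat => /eqP.
Qed.

Lemma quant_in_grid D (K : nat) x : 0 < D -> `|x| / qstep D + 1 <= K%:R ->
  quant D x \in grid D K.
Proof.
move=> D0; have q0 := qstep_gt0 D0; set t := x / qstep D => hK.
have ht : `|t| + 1 <= K%:R.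
  by move: hK; rewrite /t normrM normfV (gtr0_norm q0).
have [h1 h2] : - K%:R <= t - 1 /\ t + 1 <= K%:R.
  by move: ht; have := ler_norm t; have := ler_norm (- t); rewrite normrN; split; lra.
pose m := Num.floor (t + 2^-1).
have hm1 : - K%:Z <= m.
  by rewrite /m floor_ge_int ?intrN; last lra.
have hm2 : m <= K%:Z.
  by rewrite -(@ler_int R); apply: le_trans (ge_floor _) _; lra.
have [j jE] : exists j : nat, m + K%:Z = j%:Z.
  by exists (absz (m + K%:Z)); rewrite gez0_abs//; lra.
apply/mapP; exists j.
  rewrite mem_iota/= add0n ltnS -(@lez_nat) -jE -addnn PoszD; lra.
rewrite /quant -/t -/m; congr (_ * _).
by rewrite -[j%:R]/(j%:Z%:~R) -jE intrD addrK.
Qed.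

(** Reflection turns the integral for a lattice point [y] into the Gaussian mass of the cell of
    length [qstep D] centred at [y - a]. Consecutive points give adjacent cells, so the total is at
    most the whole mass 1. *)
Lemma gauss_grid_le1 D s a (K : nat) : 0 < D -> 0 < s ->
  (\int[mu]_(z in ditherint D) (\sum_(y <- grid D K) gauss s (y - z - a))%:E <= 1)%E.
Proof.
move=> D0 s0; have q0 := qstep_gt0 D0; set d := qstep D in q0 *.
have mg (c : R) : measurable_fun (ditherint D) (fun z : R => (gauss s (c - z))%:E).
  apply: measurable_funTS; apply/measurable_EFinP.
  by apply: (measurableT_comp (measurable_gauss s)); exact: measurable_funB.
under eq_integral => z _.
  rewrite -sumEFin /grid big_map.
  under eq_bigr => j _ do rewrite addrAC.
  over.
rewrite ge0_integral_sum; last 3 first.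
- exact: measurable_itv.
- by move=> j; exact: mg.
- by move=> j z _; rewrite lee_fin gauss_ge0.
rewrite -(integral_gauss s0).
(* The left end of the leftmost cell. *)
pose al := - (K%:R * d) - a - d / 2.
apply: le_trans (@integral_consecutive _ (gauss s) al d K.*2.+1 (ltW q0)
   (measurable_gauss s) (gauss_ge0 s)).
rewrite -[X in iota _ X]subn0 -/(index_iota _ _) big_mkord.
apply: lee_sum => j _; rewrite le_eqVlt; apply/orP; left; apply/eqP.
rewrite /ditherint -/d integral_reflect; last 2 first.
- by lra.
- by rewrite gaussE//; apply: continuous_normal_pdf; rewrite gt_eqF// sqrtr_gt0.
congr (integral _ _ _).
have -> : d * (j%:R - K%:R) - a - d / 2 = al + j%:R * d by rewrite /al; ring.
have -> : d * (j%:R - K%:R) - a - - (d / 2) = al + j.+1%:R * d.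
  by rewrite /al -natr1; field.
by [].
Qed.

End quantizer.

(** * Expectations under a planar density *)

Section density_expectation.
Variable R : realType.
Implicit Types f u : R -> R -> R.
Local Notation RR := ((R * R)%type : measurableType _).
Local Open Scope ereal_scope.

(** Serves for the source density and for the uniform dither density alike, so that averaging over
    source and dither is symmetric. *)
Definition densE f (h : RR -> \bar R) : \bar R :=
  \int[@leb2 R]_p ((f p.1 p.2)%:E * h p).

Definition density f := [/\ forall a b, (0 <= f a b)%R,
  measurable_fun [set: R * R] (fun p : R * R => f p.1 p.2) &
  \int[@leb2 R]_p (f p.1 p.2)%:E = 1].

Lemma measurable_density_mul f (h : RR -> \bar R) : density f ->
  measurable_fun setT h -> measurable_fun setT (fun p : RR => (f p.1 p.2)%:E * h p).
Proof. by move=> [_ mf _] mh; apply: emeasurable_funM => //; exact/measurable_EFinP. Qed.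

Lemma density_mul_ge0 f (h : RR -> \bar R) : density f ->
  (forall p, 0 <= h p) -> forall p : RR, 0 <= (f p.1 p.2)%:E * h p.
Proof. by move=> [f0 _ _] h0 p; rewrite mule_ge0 ?lee_fin. Qed.

Lemma densE_ge0 f h : density f -> (forall p, 0 <= h p) -> 0 <= densE f h.
Proof. by move=> df h0; apply: integral_ge0 => p _; exact: density_mul_ge0. Qed.

(** Agreement is asked only where the density is nonzero. For the source this gives access to the
    bound [A], for the dither to membership in the box. *)
Lemma eq_densE f (h k : RR -> \bar R) :
  (forall p : RR, f p.1 p.2 != 0%R -> h p = k p) -> densE f h = densE f k.
Proof.
move=> hk; apply: eq_integral => p _.
by have [->|/hk->//] := eqVneq (f p.1 p.2) 0%R; rewrite !mul0e.
Qed.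

Lemma le_densE f h k : density f -> (forall p, 0 <= h p) ->
  measurable_fun setT h -> measurable_fun setT k ->
  (forall p : RR, f p.1 p.2 != 0%R -> h p <= k p) -> densE f h <= densE f k.
Proof.
move=> df h0 mh mk hk; apply: ge0_le_integral => //.
- by move=> p _; exact: density_mul_ge0.
- exact: measurable_density_mul.
- exact: measurable_density_mul.
- move=> p _; have [->|/hk hkp] := eqVneq (f p.1 p.2) 0%R; first by rewrite !mul0e.
  by case: df => f0 _ _; rewrite lee_wpmul2l ?lee_fin.
Qed.

Lemma densED f h k : density f -> (forall p, 0 <= h p) -> (forall p, 0 <= k p) ->
  measurable_fun setT h -> measurable_fun setT k ->
  densE f (fun p => h p + k p) = densE f h + densE f k.
Proof.
move=> df h0 k0 mh mk; rewrite /densE -ge0_integralD//.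
- by apply: eq_integral => p _; rewrite ge0_muleDr.
- by move=> p _; exact: density_mul_ge0.
- exact: measurable_density_mul.
- by move=> p _; exact: density_mul_ge0.
- exact: measurable_density_mul.
Qed.

Lemma densEZ f (c : R) h : density f -> (0 <= c)%R -> (forall p, 0 <= h p) ->
  measurable_fun setT h -> densE f (fun p => c%:E * h p) = c%:E * densE f h.
Proof.
move=> df c0 h0 mh; rewrite /densE -ge0_integralZl//.
- by apply: eq_integral => p _; rewrite muleCA.
- exact: measurable_density_mul.
- by move=> p _; exact: density_mul_ge0.
Qed.

Lemma densE_cst f (c : \bar R) : density f -> 0 <= c -> densE f (fun=> c) = c.
Proof.
move=> [f0 mf f1] c0; rewrite /densE ge0_integralZr//; first by rewrite f1 mul1e.
- exact/measurable_EFinP.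
- by move=> p _; rewrite lee_fin.
Qed.

Lemma densE_sum f (I : Type) (r : seq I) (h : I -> RR -> \bar R) : density f ->
  (forall i p, 0 <= h i p) -> (forall i, measurable_fun setT (h i)) ->
  densE f (fun p => \sum_(i <- r) h i p) = \sum_(i <- r) densE f (h i).
Proof.
move=> df h0 mh; rewrite /densE -ge0_integral_sum//.
- by apply: eq_integral => p _; rewrite ge0_sume_distrr.
- by move=> i; exact: measurable_density_mul.
- by move=> i p _; exact: density_mul_ge0.
Qed.

Lemma measurable_densE f d (W : measurableType d) (H : W -> RR -> \bar R) : density f ->
  (forall w p, 0 <= H w p) ->
  measurable_fun setT (fun u : W * RR => H u.1 u.2) ->
  measurable_fun setT (fun w => densE f (H w)).
Proof.
move=> df H0 mH; apply: (measurable_int_leb2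
  (H := fun u : W * RR => (f u.2.1 u.2.2)%:E * H u.1 u.2)).
  by apply: measurable_densM => //; case: df.
by move=> u; rewrite mule_ge0//; case: df => f0 _ _; rewrite lee_fin.
Qed.

(** Tonelli, applied to the integrand [G] into which both densities have been absorbed. *)
Lemma densE_swap f u (H : RR -> RR -> \bar R) : density f -> density u ->
  (forall p z, 0 <= H p z) -> measurable_fun setT (fun v : RR * RR => H v.1 v.2) ->
  densE f (fun p => densE u (H p)) = densE u (fun z => densE f (fun p => H p z)).
Proof.
move=> df du H0 mH.
have [f0 mf _] := df; have [u0 mu _] := du.
pose G (v : RR * RR) := (f v.1.1 v.1.2)%:E * ((u v.2.1 v.2.2)%:E * H v.1 v.2).
have mG : measurable_fun setT G.
  apply: emeasurable_funM.
    by apply/measurable_EFinP; exact: (measurableT_comp mf measurable_fst).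
  apply: emeasurable_funM => //.
  by apply/measurable_EFinP; exact: (measurableT_comp mu measurable_snd).
have mH1 p : measurable_fun setT (H p).
  by apply: (measurableT_comp mH (g := fun z : RR => (p, z))); exact: measurable_fun_pair.
have mH2 z : measurable_fun setT (H^~ z).
  by apply: (measurableT_comp mH (g := fun p : RR => (p, z))); exact: measurable_fun_pair.
have G0 v : 0 <= G v by rewrite /G !mule_ge0 ?lee_fin.
transitivity (\int[@leb2 R]_p \int[@leb2 R]_z G (p, z)).
  apply: eq_integral => p _; rewrite /G/= ge0_integralZl ?lee_fin//.
  - exact: measurable_density_mul.
  - by move=> z _; exact: density_mul_ge0.
rewrite (fubini_tonelli (m1 := @leb2 R) (m2 := @leb2 R) G mG G0).
apply: eq_integral => z _; rewrite /G/=.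
rewrite -ge0_integralZl ?lee_fin//.
- by apply: eq_integral => p _; rewrite muleCA.
- exact: measurable_density_mul.
- by move=> p _; apply: (density_mul_ge0 (h := H^~ z)).
Qed.

End density_expectation.

(** * The dither as a density *)

Section dither.
Variables (R : realType) (D1 D2 : R).
Hypotheses (D1_gt0 : 0 < D1) (D2_gt0 : 0 < D2).
Local Notation RR := ((R * R)%type : measurableType _).
Local Notation mu := (@lebesgue_measure R).

Definition ditherdens (a b : R) : R :=
  (qstep D1 * qstep D2)^-1 * \1_(ditherbox D1 D2) (a, b).

Lemma ditherdens_neq0 a b : ditherdens a b != 0 -> ditherbox D1 D2 (a, b).
Proof.
by rewrite mulf_eq0 negb_or indicE => /andP[_]; case: (boolP (_ \in _)); rewrite ?inE ?eqxx.
Qed.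

Lemma measurable_ditherbox : measurable (ditherbox D1 D2 : set RR).
Proof. by apply: measurableX; exact: measurable_itv. Qed.

Lemma qstepM_gt0 : 0 < qstep D1 * qstep D2.
Proof. by rewrite mulr_gt0// qstep_gt0. Qed.

Local Open Scope ereal_scope.

Lemma lebesgue_ditherint D : (0 < D)%R -> mu (ditherint D) = (qstep D)%:E.
Proof.
move=> D0; have q0 := qstep_gt0 D0; rewrite /ditherint lebesgue_measure_itv/= lte_fin.
by rewrite ifT; [rewrite -EFinB; congr EFin; field | lra].
Qed.

Lemma integral_ditherbox (g : RR -> \bar R) :
  \int[@leb2 R]_(z in ditherbox D1 D2) g z =
  \int[@leb2 R]_z ((\1_(ditherbox D1 D2) z)%:E * g z).
Proof.
rewrite integral_mkcond; apply: eq_integral => z _.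
by rewrite /patch indicE; case: ifP => _; rewrite ?mul1e ?mul0e.
Qed.

(** Independence of the two dithers: once each factor is extended by zero outside its interval,
    Tonelli separates the variables. *)
Lemma integral_ditherbox_mul (g1 g2 : R -> \bar R) :
  measurable_fun setT g1 -> measurable_fun setT g2 ->
  (forall x, 0 <= g1 x) -> (forall x, 0 <= g2 x) ->
  \int[@leb2 R]_(z in ditherbox D1 D2) (g1 z.1 * g2 z.2) =
  (\int[mu]_(x in ditherint D1) g1 x) * (\int[mu]_(x in ditherint D2) g2 x).
Proof.
move=> mg1 mg2 g10 g20.
pose h1 := g1 \_ (ditherint D1); pose h2 := g2 \_ (ditherint D2).
have h10 x : 0 <= h1 x by apply: erestrict_ge0.
have h20 x : 0 <= h2 x by apply: erestrict_ge0.
have mh1 : measurable_fun setT h1.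
  by apply/(measurable_restrictT _ _).1; [exact: measurable_itv|exact: measurable_funTS].
have mh2 : measurable_fun setT h2.
  by apply/(measurable_restrictT _ _).1; [exact: measurable_itv|exact: measurable_funTS].
rewrite integral_mkcond.
transitivity (\int[mu \x mu]_z (h1 z.1 * h2 z.2)).
  apply: eq_integral => -[x y] _; rewrite /h1 /h2 /patch/= /ditherbox in_setX/=.
  by rewrite -/(ditherint D1) -/(ditherint D2);
    case: (x \in _); case: (y \in _); rewrite ?mul0e ?mule0.
rewrite (fubini_tonelli1 (m1 := mu) (m2 := mu)
  (fun z : measurableTypeR R * measurableTypeR R => h1 z.1 * h2 z.2)); last 2 first.
- by apply: emeasurable_funM; [exact: (measurableT_comp mh1)|exact: (measurableT_comp mh2)].
- by move=> z; rewrite mule_ge0.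
rewrite /fubini_F/=.
under eq_integral => x _ do rewrite ge0_integralZl//.
rewrite ge0_integralZr//; last by apply: integral_ge0.
by rewrite -!integral_mkcond.
Qed.

Lemma leb2_ditherbox : @leb2 R (ditherbox D1 D2) = (qstep D1 * qstep D2)%:E.
Proof.
rewrite /leb2 product_measure1E; [|exact: measurable_itv..].
by rewrite EFinM -!lebesgue_ditherint.
Qed.

Lemma density_dither : density ditherdens.
Proof.
have w0 := qstepM_gt0; have mB := measurable_ditherbox; split.
- move=> a b; rewrite /ditherdens mulr_ge0 // ?indicE ?ler0n // invr_ge0; exact: ltW.
- apply: measurable_funM => //.
  rewrite (_ : (fun p => _) = \1_(ditherbox D1 D2)); first exact: measurable_indic.
  by apply/funext => -[].
- transitivity (\int[@leb2 R]_z
      (((qstep D1 * qstep D2)^-1)%:E * (\1_(ditherbox D1 D2) z)%:E)).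
    by apply: eq_integral => -[a b] _; rewrite /ditherdens EFinM.
  rewrite ge0_integralZl//; last 2 first.
  + by apply/measurable_EFinP; exact: measurable_indic.
  + by rewrite lee_fin invr_ge0 ltW.
  rewrite integral_indic// setIT [X in _ * X]leb2_ditherbox -EFinM mulVf//.
  by rewrite gt_eqF.
Qed.

(** Passes from the normalized box integral in the definitions of the entropies to an expectation
    under a density. *)
Lemma avg_dither2E (g : RR -> \bar R) :
  measurable_fun setT g -> (forall z, 0 <= g z) ->
  avg_dither2 D1 D2 g = densE ditherdens g.
Proof.
move=> mg g0; rewrite /avg_dither2 integral_ditherbox -ge0_integralZl//.
- by apply: eq_integral => -[a b] _; rewrite /ditherdens EFinM muleA.
- apply: emeasurable_funM => //; apply/measurable_EFinP; apply: measurable_indic.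
  exact: measurable_ditherbox.
- by move=> z _; rewrite mule_ge0// lee_fin.
- by rewrite lee_fin invr_ge0 ltW// qstepM_gt0.
Qed.

Lemma eq_avg_dither2 (g h : RR -> \bar R) :
  (forall z, ditherbox D1 D2 z -> g z = h z) ->
  avg_dither2 D1 D2 g = avg_dither2 D1 D2 h.
Proof.
by move=> gh; congr (_ * _); apply: eq_integral => z /[!inE] hz; exact: gh.
Qed.

Lemma dither_mul (g1 g2 : R -> \bar R) :
  measurable_fun setT g1 -> measurable_fun setT g2 ->
  (forall x, 0 <= g1 x) -> (forall x, 0 <= g2 x) ->
  densE ditherdens (fun z => g1 z.1 * g2 z.2) = ((qstep D1 * qstep D2)^-1)%:E *
  ((\int[mu]_(x in ditherint D1) g1 x) * (\int[mu]_(x in ditherint D2) g2 x)).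
Proof.
move=> mg1 mg2 g10 g20; rewrite -avg_dither2E.
- by rewrite /avg_dither2 integral_ditherbox_mul.
- by apply: emeasurable_funM; [exact: (measurableT_comp mg1)|exact: (measurableT_comp mg2)].
- by move=> z; rewrite mule_ge0.
Qed.

Lemma integral_ditherint1 D : (0 < D)%R -> \int[mu]_(x in ditherint D) 1 = (qstep D)%:E.
Proof.
move=> D0; rewrite integral_cst ?mul1e; last exact: measurable_itv.
exact: lebesgue_ditherint.
Qed.

Lemma dither_fst (g : R -> \bar R) :
  measurable_fun setT g -> (forall x, 0 <= g x) ->
  densE ditherdens (fun z => g z.1) =
  ((qstep D1)^-1)%:E * \int[mu]_(x in ditherint D1) g x.
Proof.
move=> mg g0; transitivity (densE ditherdens (fun z => g z.1 * 1)).
  by apply: eq_densE => z _; rewrite mule1.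
rewrite (@dither_mul g (fun=> 1))// integral_ditherint1// invfM EFinM.
rewrite [X in _ * X]muleC -muleA (muleA ((qstep D2)^-1)%:E) -EFinM.
by rewrite mulVf ?mul1e// gt_eqF// qstep_gt0.
Qed.

Lemma dither_snd (g : R -> \bar R) :
  measurable_fun setT g -> (forall x, 0 <= g x) ->
  densE ditherdens (fun z => g z.2) =
  ((qstep D2)^-1)%:E * \int[mu]_(x in ditherint D2) g x.
Proof.
move=> mg g0; transitivity (densE ditherdens (fun z => 1 * g z.2)).
  by apply: eq_densE => z _; rewrite mul1e.
rewrite (@dither_mul (fun=> 1) g)// integral_ditherint1// invfM mulrC EFinM.
rewrite -muleA (muleA ((qstep D1)^-1)%:E) -EFinM.
by rewrite mulVf ?mul1e// gt_eqF// qstep_gt0.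
Qed.

End dither.

(** * The quantized source given the dither *)

Lemma esum_supp_seq (R : realType) (T : choiceType) (S : seq T) (F : T -> R) :
  uniq S -> (forall y, 0 <= F y) -> (forall y, y \notin S -> F y = 0) ->
  (\esum_(y in [set: T]) (F y)%:E = (\sum_(y <- S) F y)%:E)%E.
Proof.
move=> uS F0 FS.
transitivity (\esum_(y in [set` S]) (F y)%:E)%E.
  rewrite [RHS]esum_mkcond; apply: eq_esum => y _.
  by rewrite mem_setE; case: ifPn => // /FS ->.
rewrite esum_fset//; last by move=> y _; rewrite lee_fin.
by rewrite -fsbig_seq// sumEFin.
Qed.

Lemma measurable_eqR (R : realType) d (W : measurableType d) (g h : W -> R) :
  measurable_fun setT g -> measurable_fun setT h ->
  measurable_fun setT (fun w => (g w == h w)%:R : R).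
Proof.
move=> mg mh; rewrite (_ : (fun w => _) = fun w => if g w == h w then 1 else 0).
  by apply: measurable_fun_ifT => //; exact: measurable_fun_eqr.
by apply/funext => w; case: (_ == _).
Qed.

Section source.
Variables (R : realType) (A D1 D2 : R) (f : R -> R -> R).
Hypotheses (D1_gt0 : 0 < D1) (D2_gt0 : 0 < D2) (df : density f).
Hypothesis f_supp : forall a b, f a b != 0 -> `|a| <= A /\ `|b| <= A.
Local Notation RR := ((R * R)%type : measurableType _).

Definition qpair (p z : R * R) : R * R := (quant D1 (p.1 + z.1), quant D2 (p.2 + z.2)).

Lemma measurable_qpair : measurable_fun setT (fun v : RR * RR => qpair v.1 v.2 : RR).
Proof.
by apply: measurable_fun_pair; apply: (measurableT_comp (measurable_quant _)) => //;
  apply: measurable_funD; do 2 (apply: measurableT_comp => //).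
Qed.

Lemma measurable_qpair_eq :
  measurable_fun setT (fun v : (RR * RR) * RR => ((qpair v.2 v.1.1 == v.1.2)%:R : R)).
Proof.
rewrite (_ : (fun v => _) = fun v : (RR * RR) * RR =>
   (quant D1 (v.2.1 + v.1.1.1) == v.1.2.1)%:R *
   (quant D2 (v.2.2 + v.1.1.2) == v.1.2.2)%:R).
  apply: measurable_funM; apply: measurable_eqR.
  - apply: (measurableT_comp (measurable_quant _)) => //.
    by apply: measurable_funD; do ?(apply: measurableT_comp => //).
  - by do ?(apply: measurableT_comp => //).
  - apply: (measurableT_comp (measurable_quant _)) => //.
    by apply: measurable_funD; do ?(apply: measurableT_comp => //).
  - by do ?(apply: measurableT_comp => //).
by apply/funext => -[[z [y1 y2]] p]; rewrite /qpair xpair_eqE -natrM mulnb.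
Qed.

Lemma measurable_qpair_eq2 z y :
  measurable_fun setT (fun p : RR => ((qpair p z == y)%:R : R)).
Proof.
by apply: (measurableT_comp measurable_qpair_eq (g := fun p : RR => ((z, y), p)));
  exact: measurable_fun_pair.
Qed.

(** The laws [pY12] and [pY1] are defined through [fine], which sends infinite values to 0. Here the
    expectation lies in [[0, 1]], so nothing is lost. *)
Lemma densE_fineK (h : RR -> R) : (forall p, 0 <= h p <= 1) ->
  measurable_fun setT h ->
  ((fine (densE f (fun p => (h p)%:E)))%:E = densE f (fun p => (h p)%:E))%E.
Proof.
move=> h01 mh; rewrite fineK// ge0_fin_numE.
  apply: (@le_lt_trans _ _ 1%E); last exact: ltry.
  rewrite -[leRHS](densE_cst df)//; apply: le_densE => //.
  - by move=> p; rewrite lee_fin; case/andP: (h01 p).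
  - exact/measurable_EFinP.
  - by move=> p _; rewrite lee_fin; case/andP: (h01 p).
by apply: densE_ge0 => // p; rewrite lee_fin; case/andP: (h01 p).
Qed.

Lemma natr_bool_itv (b : bool) : 0 <= (b%:R : R) <= 1.
Proof. by case: b; rewrite ler0n ?lexx// ler01. Qed.

Lemma pY12E z y : ((pY12 f D1 D2 z y)%:E = densE f (fun p => ((qpair p z == y)%:R)%:E))%E.
Proof.
rewrite -densE_fineK; [|by move=> p; exact: natr_bool_itv|exact: measurable_qpair_eq2].
congr (_%:E); congr fine; apply: eq_integral => p _.
by case: y => y1 y2; rewrite /qpair xpair_eqE -mulnb natrM EFinM EFinM -EFinM -!EFinM mulrA.
Qed.

Lemma measurable_quant_eq : measurable_fun setT
  (fun v : RR * RR => ((quant D1 (v.2.1 + v.1.1) == v.1.2)%:R : R)).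
Proof.
apply: measurable_eqR; last by do ?(apply: measurableT_comp => //).
apply: (measurableT_comp (measurable_quant _)) => //.
by apply: measurable_funD; do ?(apply: measurableT_comp => //).
Qed.

Lemma measurable_quant_eq2 z1 y1 :
  measurable_fun setT (fun p : RR => ((quant D1 (p.1 + z1) == y1)%:R : R)).
Proof.
by apply: (measurableT_comp measurable_quant_eq (g := fun p : RR => ((z1, y1) : RR, p)));
  exact: measurable_fun_pair.
Qed.

Lemma pY1E z1 y1 :
  ((pY1 f D1 z1 y1)%:E = densE f (fun p => ((quant D1 (p.1 + z1) == y1)%:R)%:E))%E.
Proof.
rewrite -densE_fineK; [|by move=> p; exact: natr_bool_itv|exact: measurable_quant_eq2].
by congr (_%:E); congr fine; apply: eq_integral => p _; rewrite EFinM.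
Qed.

Lemma pY12_ge0 z y : 0 <= pY12 f D1 D2 z y.
Proof. by rewrite -lee_fin pY12E; apply: densE_ge0 => // p; rewrite lee_fin. Qed.

Lemma pY1_ge0 z1 y1 : 0 <= pY1 f D1 z1 y1.
Proof. by rewrite -lee_fin pY1E; apply: densE_ge0 => // p; rewrite lee_fin. Qed.

Lemma pY1_le1 z1 y1 : pY1 f D1 z1 y1 <= 1.
Proof.
rewrite -lee_fin pY1E -[leRHS](densE_cst df)//; apply: le_densE => //.
- by apply/measurable_EFinP; exact: measurable_quant_eq2.
- by move=> p _; rewrite lee_fin; case/andP: (natr_bool_itv (quant D1 (p.1 + z1) == y1)).
Qed.

Lemma pY12_le_pY1 z y : pY12 f D1 D2 z y <= pY1 f D1 z.1 y.1.
Proof.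
rewrite -lee_fin pY1E pY12E; apply: le_densE => //.
- by apply/measurable_EFinP; exact: measurable_qpair_eq2.
- by apply/measurable_EFinP; exact: measurable_quant_eq2.
- move=> p _; rewrite lee_fin ler_nat; case: y => y1 y2; rewrite /qpair xpair_eqE.
  by rewrite /=; case: (_ == y1) => //=; exact: leq_b1.
Qed.

Lemma pY12_le1 z y : pY12 f D1 D2 z y <= 1.
Proof. exact: le_trans (pY12_le_pY1 _ _) (pY1_le1 _ _). Qed.

Lemma measurable_pY12 :
  measurable_fun setT (fun v : RR * RR => pY12 f D1 D2 v.1 v.2).
Proof.
apply/measurable_EFinP.
rewrite (_ : _ \o _ = fun v : RR * RR => densE f (fun p => ((qpair p v.1 == v.2)%:R)%:E)).
  apply: (measurable_densE (H := fun v p => ((qpair p v.1 == v.2)%:R)%:E)) => //.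
  by apply/measurable_EFinP; exact: measurable_qpair_eq.
by apply/funext => v /=; rewrite pY12E.
Qed.

Lemma measurable_pY1 : measurable_fun setT (fun v : RR => pY1 f D1 v.1 v.2).
Proof.
apply/measurable_EFinP.
rewrite (_ : _ \o _ = fun v : RR => densE f (fun p => ((quant D1 (p.1 + v.1) == v.2)%:R)%:E)).
  apply: (measurable_densE (H := fun v p => ((quant D1 (p.1 + v.1) == v.2)%:R)%:E)) => //.
  by apply/measurable_EFinP; exact: measurable_quant_eq.
by apply/funext => v /=; rewrite pY1E.
Qed.

Lemma measurable_pY12_z y : measurable_fun setT (fun z : RR => pY12 f D1 D2 z y).
Proof.
by apply: (measurableT_comp measurable_pY12 (g := fun z : RR => (z, y : RR)));
  exact: measurable_fun_pair.
Qed.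

Lemma measurable_pY1_z y1 : measurable_fun setT (fun z1 : R => pY1 f D1 z1 y1).
Proof.
by apply: (measurableT_comp measurable_pY1 (g := fun z1 : R => (z1, y1) : RR));
  exact: measurable_fun_pair.
Qed.

(** One radius for both coordinates. Of the two successors, one compensates truncation and the other
    is the margin [+ 1] of [quant_in_grid]. *)
Definition gridK : nat := (Num.truncn (Num.max ((A + qstep D1) / qstep D1)
  ((A + qstep D2) / qstep D2))).+2.
Local Notation S1 := (grid D1 gridK).
Local Notation S2 := (grid D2 gridK).
Definition pgrid : seq (R * R) := [seq (y1, y2) | y1 <- S1, y2 <- S2].

Lemma pgrid_uniq : uniq pgrid.
Proof.
by apply: allpairs_uniq; [exact: grid_uniq|exact: grid_uniq|move=> [? ?] [? ?] _ _].
Qed.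

Lemma quant_grid1 a z : `|a| <= A -> ditherint D1 z -> quant D1 (a + z) \in S1.
Proof.
move=> aA; rewrite /ditherint/= in_itv/= => /andP[z1 z2].
have q0 := qstep_gt0 D1_gt0; apply: quant_in_grid => //.
have az : `|a + z| <= A + qstep D1.
  apply: le_trans (ler_normD _ _) _; apply: lerD => //.
  by rewrite ler_norml; apply/andP; split; lra.
rewrite -[gridK%:R]natr1 lerD2r; apply: le_trans (ltW (truncnS_gt _)).
by rewrite le_max ler_pM2r ?invr_gt0// az.
Qed.

Lemma quant_grid2 a z : `|a| <= A -> ditherint D2 z -> quant D2 (a + z) \in S2.
Proof.
move=> aA; rewrite /ditherint/= in_itv/= => /andP[z1 z2].
have q0 := qstep_gt0 D2_gt0; apply: quant_in_grid => //.
have az : `|a + z| <= A + qstep D2.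
  apply: le_trans (ler_normD _ _) _; apply: lerD => //.
  by rewrite ler_norml; apply/andP; split; lra.
rewrite -[gridK%:R]natr1 lerD2r; apply: le_trans (ltW (truncnS_gt _)).
by rewrite le_max [X in _ || X]ler_pM2r ?invr_gt0// az orbT.
Qed.

Lemma qpair_grid (p z : R * R) : f p.1 p.2 != 0 -> ditherbox D1 D2 z ->
  qpair p z \in pgrid.
Proof.
move=> /f_supp[p1 p2] [z1 z2]; apply/allpairsP.
exists (quant D1 (p.1 + z.1), quant D2 (p.2 + z.2)).
by split => //; [exact: quant_grid1|exact: quant_grid2].
Qed.

(** Transfer to the law of the outputs: for a source letter in the support and a dither in the box,
    exactly one grid point equals the output. The weight [c] may depend on the fixed [z]. *)
Lemma densE_qpair z (c : R * R -> R) : ditherbox D1 D2 z -> (forall y, 0 <= c y) ->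
  (densE f (fun p => (c (qpair p z))%:E) =
   (\sum_(y <- pgrid) pY12 f D1 D2 z y * c y)%:E)%E.
Proof.
move=> hz c0.
transitivity (densE f (fun p => \sum_(y <- pgrid) ((c y)%:E * ((qpair p z == y)%:R)%:E)))%E.
  apply: eq_densE => p fp; rewrite (bigD1_seq (qpair p z))/=;
    [|exact: qpair_grid|exact: pgrid_uniq].
  rewrite eqxx mule1 big1 ?adde0// => y; rewrite eq_sym => /negbTE ->.
  by rewrite mule0.
rewrite densE_sum//; last 2 first.
- by move=> y p; rewrite mule_ge0 ?lee_fin.
- move=> y; apply: emeasurable_funM => //; apply/measurable_EFinP.
  exact: measurable_qpair_eq2.
rewrite -sumEFin; apply: eq_bigr => y _; rewrite densEZ//.
- by rewrite -pY12E -EFinM mulrC.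
- by apply/measurable_EFinP; exact: measurable_qpair_eq2.
Qed.

Lemma pY12_out z y : ditherbox D1 D2 z -> y \notin pgrid -> pY12 f D1 D2 z y = 0.
Proof.
move=> hz yS; apply: EFin_inj; rewrite pY12E -[RHS](densE_cst df)//.
apply: eq_densE => p fp; case: eqP => // yE.
by move: yS; rewrite -yE qpair_grid.
Qed.

Lemma pY1_out z1 y1 : ditherint D1 z1 -> y1 \notin S1 -> pY1 f D1 z1 y1 = 0.
Proof.
move=> hz yS; apply: EFin_inj; rewrite pY1E -[RHS](densE_cst df)//.
apply: eq_densE => p /f_supp[fp _]; case: eqP => // yE.
by move: yS; rewrite -yE quant_grid1.
Qed.

(** For a letter of the support, the second output equals exactly one point of [S2], so the
    indicators over [S2] add up to the one for [y1]. *)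
Lemma pY12_marginal z y1 : ditherbox D1 D2 z ->
  \sum_(y2 <- S2) pY12 f D1 D2 z (y1, y2) = pY1 f D1 z.1 y1.
Proof.
move=> hz; apply: EFin_inj; rewrite -sumEFin pY1E.
under eq_bigr => y2 _ do rewrite pY12E.
rewrite -densE_sum//; last first.
  by move=> y2; apply/measurable_EFinP; exact: measurable_qpair_eq2.
apply: eq_densE => p /f_supp[_ p2].
rewrite (bigD1_seq (quant D2 (p.2 + z.2)))/=; last 2 first.
- by apply: quant_grid2 => //; case: hz.
- exact: grid_uniq.
rewrite /qpair xpair_eqE eqxx andbT big1 ?adde0// => y2; rewrite eq_sym => /negbTE h.
by rewrite xpair_eqE h andbF.
Qed.

End source.

(** * Entropies *)

Section entropies.
Variables (R : realType) (A D1 D2 : R) (f : R -> R -> R).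
Hypotheses (D1_gt0 : 0 < D1) (D2_gt0 : 0 < D2) (df : density f).
Hypothesis f_supp : forall a b, f a b != 0 -> `|a| <= A /\ `|b| <= A.
Local Notation RR := ((R * R)%type : measurableType _).
Local Notation u := (ditherdens D1 D2).
Local Notation du := (density_dither D1_gt0 D2_gt0).
Local Notation p12 := (pY12 f D1 D2).
Local Notation p1 := (pY1 f D1).
Local Notation S := (pgrid A D1 D2).
Local Notation U := (qpair D1 D2).
Local Notation p12_ge0 := (pY12_ge0 D1_gt0 D2_gt0 df).
Local Notation p12_le1 := (pY12_le1 D1_gt0 D2_gt0 df).
Local Notation p1_ge0 := (pY1_ge0 D1_gt0 df).
Local Notation p1_le1 := (pY1_le1 D1_gt0 df).

Lemma ln2_gt0 : 0 < ln (2 : R).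
Proof. by rewrite ln_gt0// ltr1n. Qed.

Lemma measurable_log2 : measurable_fun setT (@log2 R).
Proof. by apply: measurable_funM => //; exact: measurable_ln. Qed.

Lemma entropy_term_ge0 (t s : R) : 0 <= t -> t <= s -> 0 <= - t * log2 (t / s).
Proof.
move=> t0 ts; rewrite mulNr -mulrN mulr_ge0// /log2 -mulNr.
rewrite divr_ge0 ?(ltW ln2_gt0)// oppr_ge0 ln_le0//.
(* For [s = 0] the convention [0^-1 = 0] makes the quotient 0, still at most 1. *)
have [->|s0] := eqVneq s 0; first by rewrite invr0 mulr0 ler01.
by rewrite ler_pdivrMr ?mul1r// lt_def s0 (le_trans t0 ts).
Qed.

Lemma entropy_term1_ge0 (t : R) : 0 <= t -> t <= 1 -> 0 <= - t * log2 t.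
Proof. by move=> t0 t1; rewrite -[log2 t]/(log2 _) -[X in log2 X]divr1 entropy_term_ge0. Qed.

Lemma entropy_term_split (t s : R) : 0 <= t -> t <= s ->
  - t * log2 (t / s) = - t * (log2 t - log2 s).
Proof.
(* At [t = 0] both sides vanish whatever values the logarithms take there. *)
rewrite le_eqVlt => /predU1P[<- _|t0 ts]; first by rewrite oppr0 !mul0r.
by rewrite /log2 ln_div ?posrE ?(lt_le_trans t0 ts)// mulrBl.
Qed.

Lemma measurable_entropy12 y : measurable_fun setT (fun z : RR => - p12 z y * log2 (p12 z y)).
Proof.
have m := measurable_pY12_z D1_gt0 D2_gt0 df y.
apply: measurable_funM; first exact: measurable_funN.
exact: (measurableT_comp measurable_log2).
Qed.

Lemma measurable_entropy21 y :
  measurable_fun setT (fun z : RR => - p12 z y * log2 (p12 z y / p1 z.1 y.1)).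
Proof.
have m := measurable_pY12_z D1_gt0 D2_gt0 df y.
have m1 := measurable_pY1_z D1_gt0 df y.1.
rewrite (_ : (fun z => _) = fun z : RR => - p12 z y * (log2 (p12 z y) - log2 (p1 z.1 y.1))).
  2: by apply/funext => z; rewrite entropy_term_split ?p12_ge0 ?pY12_le_pY1.
apply: measurable_funM; first exact: measurable_funN.
by apply: measurable_funB; [exact: (measurableT_comp measurable_log2)|
  exact: (measurableT_comp (measurableT_comp measurable_log2 m1))].
Qed.

Lemma measurable_entropy1 y1 :
  measurable_fun setT (fun z1 : R => - p1 z1 y1 * log2 (p1 z1 y1)).
Proof.
have m := measurable_pY1_z D1_gt0 df y1.
apply: measurable_funM; first exact: measurable_funN.
exact: (measurableT_comp measurable_log2).
Qed.

(** For dithers in the box the outputs stay on the finite grid, so the infinite sum collapses;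
    outside the box the dither density is zero. The next two lemmas follow the same pattern. *)
Lemma H_Y12_ZE : H_Y12_Z f D1 D2 =
  densE u (fun z => (\sum_(y <- S) - p12 z y * log2 (p12 z y))%:E).
Proof.
rewrite -avg_dither2E//; last 2 first.
- by apply/measurable_EFinP; apply: measurable_sum => y; exact: measurable_entropy12.
- by move=> z; rewrite lee_fin sumr_ge0// => y _; rewrite entropy_term1_ge0 ?p12_ge0 ?p12_le1.
apply: eq_avg_dither2 => z hz; apply: esum_supp_seq => [|y|y yS].
- exact: pgrid_uniq.
- by rewrite entropy_term1_ge0 ?p12_ge0 ?p12_le1.
- by rewrite (pY12_out _ _ _ f_supp)// oppr0 mul0r.
Qed.

Lemma H_Y2_Y1ZE : H_Y2_Y1Z f D1 D2 =
  densE u (fun z => (\sum_(y <- S) - p12 z y * log2 (p12 z y / p1 z.1 y.1))%:E).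
Proof.
rewrite -avg_dither2E//; last 2 first.
- by apply/measurable_EFinP; apply: measurable_sum => y; exact: measurable_entropy21.
- move=> z; rewrite lee_fin sumr_ge0// => y _.
  by rewrite entropy_term_ge0 ?p12_ge0 ?pY12_le_pY1.
apply: eq_avg_dither2 => z hz; apply: esum_supp_seq => [|y|y yS].
- exact: pgrid_uniq.
- by rewrite entropy_term_ge0 ?p12_ge0 ?pY12_le_pY1.
- by rewrite (pY12_out _ _ _ f_supp)// oppr0 mul0r.
Qed.

Lemma H_Y1_Z1E : H_Y1_Z1 f D1 =
  densE u (fun z => (\sum_(y1 <- grid D1 (gridK A D1 D2)) - p1 z.1 y1 * log2 (p1 z.1 y1))%:E).
Proof.
rewrite (@dither_fst _ D1 D2 _ _ (fun z1 =>
  (\sum_(y1 <- grid D1 (gridK A D1 D2)) - p1 z1 y1 * log2 (p1 z1 y1))%:E))//; last 2 first.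
- by apply/measurable_EFinP; apply: measurable_sum => y; exact: measurable_entropy1.
- by move=> z; rewrite lee_fin sumr_ge0// => y _; rewrite entropy_term1_ge0 ?p1_ge0 ?p1_le1.
congr (_ * _)%E; apply: eq_integral => z /[!inE] hz; apply: esum_supp_seq => [|y|y yS].
- exact: grid_uniq.
- by rewrite entropy_term1_ge0 ?p1_ge0 ?p1_le1.
- by rewrite (pY1_out D1_gt0 df f_supp hz yS) oppr0 mul0r.
Qed.

(** The identity already holds for each dither value in the box: [log2 (p12 / p1)] splits as a
    difference, and the [log2 p1] terms cancel after summing over [y2]. *)
Lemma chain_rule : (H_Y1_Z1 f D1 + H_Y2_Y1Z f D1 D2 = H_Y12_Z f D1 D2)%E.
Proof.
rewrite H_Y12_ZE H_Y2_Y1ZE H_Y1_Z1E -densED//; first last.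
- by apply/measurable_EFinP; apply: measurable_sum => y; exact: measurable_entropy21.
- apply/measurable_EFinP; apply: measurable_sum => y.
  exact: (measurableT_comp (measurable_entropy1 y)).
- move=> z; rewrite lee_fin sumr_ge0// => y _.
  by rewrite entropy_term_ge0 ?p12_ge0 ?pY12_le_pY1.
- by move=> z; rewrite lee_fin sumr_ge0// => y _; rewrite entropy_term1_ge0 ?p1_ge0 ?p1_le1.
- exact: du.
apply: eq_densE => -[z1 z2] /ditherdens_neq0 hz; rewrite -EFinD; congr EFin.
rewrite /pgrid !big_allpairs -big_split/=; apply: eq_bigr => y1 _.
(* Only the factor outside the logarithm is expanded as a marginal sum. *)
rewrite -{1}(pY12_marginal D1_gt0 D2_gt0 df f_supp y1 hz) -sumrN mulr_suml -big_split/=.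
apply: eq_bigr => y2 _; rewrite entropy_term_split ?p12_ge0 ?pY12_le_pY1//=.
by rewrite -mulrDr addrC subrK.
Qed.

(** * Smoothed logarithms and the bounded surprisal of a source letter *)

Section smoothed.
Variable e : R.
Hypothesis e_gt0 : 0 < e.

(** Minus the logarithm of [(t + e) / (1 + e)]: the shift by [e] bounds it above, the normalization
    makes it non-negative on [[0, 1]]. *)
Definition smoothlog (t : R) : R := ln (1 + e) - ln (t + e).

Lemma smoothlog_ge0 t : 0 <= t -> t <= 1 -> 0 <= smoothlog t.
Proof.
move=> t0 t1; rewrite subr_ge0 ler_ln ?posrE ?lerD2r//.
- by rewrite (lt_le_trans e_gt0)// lerDr.
- by rewrite addr_gt0.
Qed.

Lemma smoothlog_le t : 0 <= t -> smoothlog t <= ln (1 + e) - ln e.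
Proof.
move=> t0; have te : 0 < t + e by rewrite (lt_le_trans e_gt0)// lerDr.
by rewrite lerD2l lerN2 ler_ln ?posrE// lerDr.
Qed.

Lemma measurable_smoothlog d (W : measurableType d) (g : W -> R) :
  measurable_fun setT g -> measurable_fun setT (fun w => smoothlog (g w)).
Proof.
move=> mg; apply: measurable_funB => //.
by apply: (measurableT_comp (@measurable_ln R)); exact: measurable_funD.
Qed.

(* [t ln((t + e) / t) <= e], from [ln x <= x - 1]. *)
Lemma entropy_smooth (t : R) : 0 <= t -> t <= 1 ->
  - t * log2 t <= (ln 2)^-1 * (t * smoothlog t + e).
Proof.
move=> t0 t1; rewrite /log2 mulrA mulrC ler_pM2l ?invr_gt0 ?ln2_gt0//.
have [->|tn0] := eqVneq t 0; first by rewrite oppr0 !mul0r add0r ltW.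
have tp : 0 < t by rewrite lt_def tn0.
have te : 0 < t + e by rewrite addr_gt0.
have oe : 0 < 1 + e by rewrite addr_gt0.
rewrite /smoothlog.
have h1 : 0 <= ln (1 + e) by rewrite ln_ge0// lerDl ltW.
have h2 : ln (t + e) - ln t <= e / t.
  rewrite -ln_div ?posrE// mulrDl divff ?gt_eqF//; apply: le_ln1Dx.
  by rewrite (lt_le_trans (ltrN10 _))// divr_ge0// ltW.
have h3 : t * (ln (t + e) - ln t) <= e.
  by rewrite mulrC -ler_pdivlMr.
have h4 := mulr_ge0 t0 h1.
by lra.
Qed.

(** The function [k] of the overview, in natural units and with the smoothed logarithm. Boundedness
    of [smoothlog] makes the [fine] harmless. *)
Definition surprisal (p : R * R) : R :=
  fine (densE u (fun z => (smoothlog (p12 z (U p z)))%:E)).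

Lemma measurable_p12U : measurable_fun setT (fun v : RR * RR => p12 v.2 (U v.1 v.2)).
Proof.
apply: (measurableT_comp (measurable_pY12 D1_gt0 D2_gt0 df)
  (g := fun v : RR * RR => (v.2, U v.1 v.2 : RR))).
by apply: measurable_fun_pair => //; exact: measurable_qpair.
Qed.

Lemma measurable_p12U1 p : measurable_fun setT (fun z : RR => p12 z (U p z)).
Proof.
by apply: (measurableT_comp measurable_p12U (g := fun z : RR => (p : RR, z)));
  exact: measurable_fun_pair.
Qed.

Lemma smooth_ge0 z y : 0 <= smoothlog (p12 z y).
Proof. by rewrite smoothlog_ge0 ?p12_ge0 ?p12_le1. Qed.

Lemma surprisalE p : ((surprisal p)%:E = densE u (fun z => (smoothlog (p12 z (U p z)))%:E))%E.
Proof.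
rewrite /surprisal fineK// ge0_fin_numE; last first.
  by apply: densE_ge0 => [|z]; [exact: du|rewrite lee_fin smooth_ge0].
apply: (@le_lt_trans _ _ ((ln (1 + e) - ln e))%:E); last exact: ltry.
have l0 : 0 <= (ln (1 + e) - ln e).
  by apply: le_trans (smoothlog_le (lexx 0)); rewrite smoothlog_ge0.
rewrite -[leRHS](densE_cst du) ?lee_fin//; apply: le_densE => //.
- exact: du.
- by move=> z; rewrite lee_fin smooth_ge0.
- by apply/measurable_EFinP; apply: measurable_smoothlog; exact: measurable_p12U1.
- by move=> z _; rewrite lee_fin smoothlog_le// p12_ge0.
Qed.

Lemma surprisal_ge0 p : 0 <= surprisal p.
Proof.
by rewrite -lee_fin surprisalE; apply: densE_ge0 => [|z];
  [exact: du|rewrite lee_fin smooth_ge0].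
Qed.

Lemma measurable_surprisal : measurable_fun setT (surprisal : RR -> R).
Proof.
apply/measurable_EFinP.
rewrite (_ : _ \o _ = fun p : RR => densE u (fun z => (smoothlog (p12 z (U p z)))%:E)).
  apply: (measurable_densE (H := fun p z => (smoothlog (p12 z (U p z)))%:E)).
  - exact: du.
  - by move=> p z; rewrite lee_fin smooth_ge0.
  - by apply/measurable_EFinP; apply: measurable_smoothlog; exact: measurable_p12U.
by apply/funext => p /=; rewrite surprisalE.
Qed.

(** Exchanging source and dither turns the mean surprisal into the dither average of [\sum_(y <- S)
    p12 z y * smoothlog (p12 z y)]. Each of the [size S] terms is off by at most [e], and
    [(ln 2)^-1] converts to bits. *)
Lemma entropy_le_surprisal : (H_Y12_Z f D1 D2 <= ((ln 2)^-1)%:E *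
  (densE f (fun p => (surprisal p)%:E) + ((size S)%:R * e)%:E))%E.
Proof.
have c0 : 0 <= (ln 2)^-1 :> R by rewrite invr_ge0 ltW// ln2_gt0.
have s0 : 0 <= (size S)%:R * e by rewrite mulr_ge0// ltW.
have mS : measurable_fun setT (fun v : RR * RR => (smoothlog (p12 v.2 (U v.1 v.2)))%:E).
  by apply/measurable_EFinP; apply: measurable_smoothlog; exact: measurable_p12U.
have mI : measurable_fun setT
    (fun z : RR => densE f (fun p => (smoothlog (p12 z (U p z)))%:E)).
  apply: (measurable_densE (H := fun z p => (smoothlog (p12 z (U p z)))%:E)) => //.
    by move=> z p; rewrite lee_fin smooth_ge0.
  apply: (measurableT_comp mS (g := fun v : RR * RR => (v.2, v.1))).
  exact: measurable_fun_pair.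
under eq_densE => p _ do rewrite surprisalE.
rewrite (densE_swap (H := fun p z => (smoothlog (p12 z (U p z)))%:E) df du)//; last first.
  by move=> p z; rewrite lee_fin smooth_ge0.
have I0 z : (0 <= densE f (fun p => (smoothlog (p12 z (U p z)))%:E))%E.
  by apply: densE_ge0 => // p; rewrite lee_fin smooth_ge0.
rewrite -(densE_cst (c := ((size S)%:R * e)%:E) du) ?lee_fin//.
rewrite -densED//; last exact: du.
rewrite -densEZ//; last 3 first.
- exact: du.
- by move=> z; rewrite adde_ge0.
- exact: emeasurable_funD.
rewrite H_Y12_ZE; apply: le_densE.
- exact: du.
- by move=> z; rewrite lee_fin sumr_ge0// => y _; rewrite entropy_term1_ge0 ?p12_ge0 ?p12_le1.
- by apply/measurable_EFinP; apply: measurable_sum => y; exact: measurable_entropy12.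
- by apply: emeasurable_funM => //; exact: emeasurable_funD.
move=> -[z1 z2] /ditherdens_neq0 hz.
rewrite (densE_qpair D1_gt0 D2_gt0 df f_supp
  (c := fun y => smoothlog (p12 (z1, z2) y)))//; last first.
  by move=> y; exact: smooth_ge0.
rewrite -EFinD -EFinM lee_fin.
have -> : (size S)%:R * e = \sum_(y <- S) e.
  by rewrite big_const_seq count_predT iter_addr_0 mulr_natl.
rewrite -big_split mulr_sumr/=; apply: ler_sum => y _.
by apply: entropy_smooth; [exact: p12_ge0|exact: p12_le1].
Qed.

End smoothed.
End entropies.

(** * The single-letter bound *)

Section single_letter.
Variables (R : realType) (A D1 D2 : R) (f : R -> R -> R).
Hypotheses (D1_gt0 : 0 < D1) (D2_gt0 : 0 < D2) (df : density f).
Hypothesis f_supp : forall a b, f a b != 0 -> `|a| <= A /\ `|b| <= A.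
Variables (e s1 s2 : R).
Hypotheses (e_gt0 : 0 < e) (s1_gt0 : 0 < s1) (s2_gt0 : 0 < s2).
Local Notation RR := ((R * R)%type : measurableType _).
Local Notation u := (ditherdens D1 D2).
Local Notation du := (density_dither D1_gt0 D2_gt0).
Local Notation p12 := (pY12 f D1 D2).
Local Notation S := (pgrid A D1 D2).
Local Notation U := (qpair D1 D2).
Local Notation w := (qstep D1 * qstep D2).
Local Notation kappa := (surprisal D1 D2 f e).
Local Notation p12_ge0 := (pY12_ge0 D1_gt0 D2_gt0 df).
Local Notation p12_le1 := (pY12_le1 D1_gt0 D2_gt0 df).

Definition cost (p a : R * R) : R :=
  (p.1 - a.1) ^+ 2 / (2 * s1) + (p.2 - a.2) ^+ 2 / (2 * s2).

(** Gaussian normalizers, the mean cost of the dither noise, the [ln (1 + e)] that undoes the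
    normalization of [smoothlog], and minus the logarithm of the box area. *)
Definition psi_cst : R := 2^-1 * ln (2 * pi * s1) + 2^-1 * ln (2 * pi * s2) +
  (D1 / (2 * s1) + D2 / (2 * s2)) + ln (1 + e) - ln w.

Definition psi (a p : R * R) : R := kappa p - psi_cst - cost p a.

Definition qerr (a p z : R * R) : R := cost ((U p z).1 - z.1, (U p z).2 - z.2) a.

Definition wgauss (a z y : R * R) : R :=
  w * (gauss s1 (y.1 - z.1 - a.1) * gauss s2 (y.2 - z.2 - a.2)).

(** The ratio of the scaled Gaussian to [p12 + e], with the division written as an exponential;
    [psi a p] is the dither average of its logarithm. *)
Definition lik (a p z : R * R) : R :=
  wgauss a z (U p z) * expR (- ln (p12 z (U p z) + e)).

Lemma qstep_area_gt0 : 0 < w. Proof. exact: qstepM_gt0. Qed.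

Lemma cost_ge0 p a : 0 <= cost p a.
Proof. by rewrite /cost addr_ge0// divr_ge0 ?sqr_ge0// mulr_ge0// ltW. Qed.

(** Isolates the dependence on [z]. Since [smoothlog] averages to [kappa p] and [qerr] to [cost p a]
    plus the dither terms, the exponent averages to [psi a p]. *)
Lemma likE a p z : lik a p z = expR (smoothlog e (p12 z (U p z)) - qerr a p z
  + (psi a p + cost p a + (D1 / (2 * s1) + D2 / (2 * s2)) - kappa p)).
Proof.
rewrite /lik /wgauss /gauss -{1}(lnK qstep_area_gt0) -!expRD; congr expR.
rewrite /psi /psi_cst /smoothlog /qerr /cost/=; ring.
Qed.

Lemma wgauss_ge0 a z y : 0 <= wgauss a z y.
Proof. by rewrite mulr_ge0 ?(ltW qstep_area_gt0)// mulr_ge0 ?gauss_ge0. Qed.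

Lemma measurable_U_sub (a : R * R) :
  measurable_fun setT (fun v : RR * RR => (U v.1 v.2).1 - v.2.1 - a.1) /\
  measurable_fun setT (fun v : RR * RR => (U v.1 v.2).2 - v.2.2 - a.2).
Proof.
have mU := measurable_qpair D1_gt0 D2_gt0.
split; apply: measurable_funB => //; apply: measurable_funB.
- exact: (measurableT_comp measurable_fst mU).
- by apply: measurableT_comp.
- exact: (measurableT_comp measurable_snd mU).
- by apply: measurableT_comp.
Qed.

Lemma measurable_lik a : measurable_fun setT (fun v : RR * RR => lik a v.1 v.2).
Proof.
have [m1 m2] := measurable_U_sub a.
apply: measurable_funM.
  apply: measurable_funM => //; apply: measurable_funM.
    exact: (measurableT_comp (measurable_gauss s1)).
  exact: (measurableT_comp (measurable_gauss s2)).
apply: (measurableT_comp (@measurable_expR R)); apply: measurable_funN.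
apply: (measurableT_comp (@measurable_ln R)); apply: measurable_funD => //.
exact: measurable_p12U.
Qed.

Lemma lik_ge0 a p z : 0 <= lik a p z.
Proof. by rewrite mulr_ge0 ?expR_ge0// wgauss_ge0. Qed.

Lemma dither_qerr a p :
  (densE u (fun z => (qerr a p z)%:E) =
   (cost p a + (D1 / (2 * s1) + D2 / (2 * s2)))%:E)%E.
Proof.
pose g (D x b : R) (z : R) := ((quant D (x + z) - z - b) ^+ 2)%:E.
have mg D x b : 0 < D -> measurable_fun setT (g D x b).
  move=> D0; apply/measurable_EFinP; apply: measurable_funX.
  apply: measurable_funB => //; apply: measurable_funB => //.
  by apply: (measurableT_comp (measurable_quant D0)); exact: measurable_funD.
have g0 D x b z : (0 <= g D x b z)%E by rewrite lee_fin sqr_ge0.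
have i1 : 0 <= (2 * s1)^-1 by rewrite invr_ge0 mulr_ge0// ltW.
have i2 : 0 <= (2 * s2)^-1 by rewrite invr_ge0 mulr_ge0// ltW.
have m1 : measurable_fun setT (fun z : RR => g D1 p.1 a.1 z.1).
  exact: (measurableT_comp (mg D1 p.1 a.1 D1_gt0)).
have m2 : measurable_fun setT (fun z : RR => g D2 p.2 a.2 z.2).
  exact: (measurableT_comp (mg D2 p.2 a.2 D2_gt0)).
transitivity (densE u (fun z => ((2 * s1)^-1)%:E * g D1 p.1 a.1 z.1 +
   ((2 * s2)^-1)%:E * g D2 p.2 a.2 z.2))%E.
  by apply: eq_densE => z _; rewrite /g -!EFinM -EFinD /qerr /cost/=; congr EFin; ring.
rewrite densED; last 5 first.
- exact: du.
- by move=> z; apply: mule_ge0; [rewrite lee_fin|exact: g0].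
- by move=> z; apply: mule_ge0; [rewrite lee_fin|exact: g0].
- by apply: emeasurable_funM.
- by apply: emeasurable_funM.
rewrite !densEZ//; [|exact: du..].
rewrite (dither_fst D1_gt0 D2_gt0 (mg D1 p.1 a.1 D1_gt0) (g0 D1 p.1 a.1)).
rewrite (dither_snd D1_gt0 D2_gt0 (mg D2 p.2 a.2 D2_gt0) (g0 D2 p.2 a.2)).
rewrite !dither_sqr// -!EFinM -EFinD; congr EFin.
rewrite (mulKf (lt0r_neq0 (qstep_gt0 D1_gt0))) (mulKf (lt0r_neq0 (qstep_gt0 D2_gt0))).
by rewrite /cost; ring.
Qed.

(* Jensen's inequality for [expR] under the dither, in the tangent form
   [expR v >= expR m * (1 + v - m)]. *)
Lemma exp_psi_le a p :
  ((expR (psi a p))%:E <= densE u (fun z => (lik a p z)%:E))%E.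
Proof.
set m := psi a p; set Q := cost p a + (D1 / (2 * s1) + D2 / (2 * s2)).
have Q0 : 0 <= Q.
  by rewrite /Q addr_ge0 ?cost_ge0// addr_ge0// divr_ge0 ?mulr_ge0// ltW.
have k0 : 0 <= kappa p by exact: surprisal_ge0.
have em : 0 <= expR m by exact: expR_ge0.
have mL : measurable_fun setT (fun z : RR => (smoothlog e (p12 z (U p z)))%:E).
  by apply/measurable_EFinP; apply: measurable_smoothlog; exact: measurable_p12U1.
have L0 z : (0 <= (smoothlog e (p12 z (U p z)))%:E)%E by rewrite lee_fin smooth_ge0.
have mG : measurable_fun setT (fun z : RR => (lik a p z)%:E).
  apply/measurable_EFinP.
  by apply: (measurableT_comp (measurable_lik a) (g := fun z : RR => (p : RR, z)));
    exact: measurable_fun_pair.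
have mq : measurable_fun setT (fun z : RR => (qerr a p z)%:E).
  apply/measurable_EFinP; have [m1 m2] := measurable_U_sub a.
  have mp : measurable_fun setT (fun z : RR => (p : RR, z)) by exact: measurable_fun_pair.
  apply: measurable_funD; apply: measurable_funM => //; apply: measurable_funX.
    exact: (measurableT_comp m1 mp).
  exact: (measurableT_comp m2 mp).
have q0 z : (0 <= (qerr a p z)%:E)%E by rewrite lee_fin cost_ge0.
(* The tangent inequality with its negative terms moved across, so that both integrands are
   non-negative. *)
have key : (densE u (fun z => (expR m)%:E * ((1 + Q)%:E + (smoothlog e (p12 z (U p z)))%:E))
   <= densE u (fun z => (lik a p z)%:E + (expR m)%:E * ((qerr a p z)%:E + (kappa p)%:E)))%E.
  apply: le_densE.
  - exact: du.
  - move=> z; apply: mule_ge0; first by rewrite lee_fin.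
    by apply: adde_ge0 => //; rewrite lee_fin addr_ge0.
  - by apply: emeasurable_funM => //; exact: emeasurable_funD.
  - apply: emeasurable_funD => //; apply: emeasurable_funM => //.
    exact: emeasurable_funD.
  - move=> z _; rewrite -?EFinD -?EFinM -?EFinD lee_fin likE -/m.
    set v := (X in _ <= expR X + _); have := expR_ge1Dx (v - m).
    rewrite expRB ler_pdivlMr ?expR_gt0// => h.
    rewrite -lerBlDr -mulrBr mulrC; apply: (le_trans _ h).
    by rewrite ler_pM2r ?expR_gt0// /v /Q; lra.
move: key.
rewrite densEZ//; last 3 first.
- exact: du.
- by move=> z; apply: adde_ge0 => //; rewrite lee_fin addr_ge0.
- exact: emeasurable_funD.
rewrite densED//; last 2 first.
- exact: du.
- by move=> z; rewrite lee_fin addr_ge0.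
rewrite (densE_cst du)//; last by rewrite lee_fin addr_ge0.
rewrite -surprisalE//.
rewrite densED//; last 4 first.
- exact: du.
- by move=> z; rewrite lee_fin lik_ge0.
- move=> z; apply: mule_ge0; first by rewrite lee_fin.
  by apply: adde_ge0 => //; rewrite lee_fin.
- by apply: emeasurable_funM => //; exact: emeasurable_funD.
rewrite densEZ//; last 3 first.
- exact: du.
- by move=> z; apply: adde_ge0 => //; rewrite lee_fin.
- exact: emeasurable_funD.
rewrite densED//; last exact: du.
rewrite (densE_cst du) ?lee_fin// dither_qerr -/Q -!EFinD -!EFinM => key.
(* After averaging, both sides contain [expR m * (Q + kappa p)]; cancelling it leaves [expR m] on
   the left. *)
rewrite -(@leeD2rE _ (expR m * (Q + kappa p))%:E)//.
by apply: le_trans key; rewrite -EFinD lee_fin -[X in X + _]mulr1 -mulrDr addrA.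
Qed.

(** Averaging over the source weights each output by [p12], and [p12 / (p12 + e) <= 1] removes the
    unknown law. The remaining Gaussian sum factors over the two grids. *)
Lemma densE_lik_le a z : ditherbox D1 D2 z ->
  (densE f (fun p => (lik a p z)%:E) <=
   w%:E * ((\sum_(y <- grid D1 (gridK A D1 D2)) gauss s1 (y - z.1 - a.1))%:E *
           (\sum_(y <- grid D2 (gridK A D1 D2)) gauss s2 (y - z.2 - a.2))%:E))%E.
Proof.
move=> hz.
rewrite (densE_qpair D1_gt0 D2_gt0 df f_supp
  (c := fun y => wgauss a z y * expR (- ln (p12 z y + e))))//; last first.
  by move=> y; rewrite mulr_ge0 ?expR_ge0// wgauss_ge0.
rewrite -!EFinM lee_fin mulr_suml mulr_sumr /pgrid big_allpairs/=.
apply: ler_sum => y1 _; rewrite mulr_sumr mulr_sumr; apply: ler_sum => y2 _.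
have pe : 0 < p12 z (y1, y2) + e by rewrite (lt_le_trans e_gt0)// lerDr p12_ge0.
rewrite expRN lnK// mulrCA ler_piMr ?wgauss_ge0//.
by rewrite ler_pdivrMr// mul1r lerDl ltW.
Qed.

(** Jensen over the dither, exchange of the two averages, removal of the output law, then the tiling
    bound in each coordinate. The area [w] cancels the normalization of the dither density. *)
Lemma exp_psi_le1 a : (densE f (fun p => (expR (psi a p))%:E) <= 1)%E.
Proof.
pose G1 (z : R) := (\sum_(y <- grid D1 (gridK A D1 D2)) gauss s1 (y - z - a.1))%:E.
pose G2 (z : R) := (\sum_(y <- grid D2 (gridK A D1 D2)) gauss s2 (y - z - a.2))%:E.
have mG (s b : R) r :
    measurable_fun setT (fun z : R => (\sum_(y <- r) gauss s (y - z - b))%:E).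
  apply/measurable_EFinP; apply: measurable_sum => y.
  apply: (measurableT_comp (measurable_gauss s)).
  by apply: measurable_funB => //; exact: measurable_funB.
have G10 z : (0 <= G1 z)%E by rewrite lee_fin sumr_ge0// => y _; exact: gauss_ge0.
have G20 z : (0 <= G2 z)%E by rewrite lee_fin sumr_ge0// => y _; exact: gauss_ge0.
have mG12 : measurable_fun setT (fun z : RR => G1 z.1 * G2 z.2)%E.
  by apply: emeasurable_funM;
    [exact: (measurableT_comp (mG s1 a.1 _))|exact: (measurableT_comp (mG s2 a.2 _))].
have mlik : measurable_fun setT (fun v : RR * RR => (lik a v.1 v.2)%:E).
  by apply/measurable_EFinP; exact: measurable_lik.
have mlik' : measurable_fun setT (fun v : RR * RR => (lik a v.2 v.1)%:E).
  have msw : measurable_fun setT (fun v : RR * RR => (v.2, v.1)).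
    exact: measurable_fun_pair.
  exact: (measurableT_comp mlik msw).
have lik0 p z : (0 <= (lik a p z)%:E)%E by rewrite lee_fin lik_ge0.
apply: (@le_trans _ _ (densE f (fun p => densE u (fun z => (lik a p z)%:E)))).
  apply: le_densE => //.
  - apply/measurable_EFinP; apply: (measurableT_comp (@measurable_expR R)).
    apply: measurable_funB; first by apply: measurable_funB => //; exact: measurable_surprisal.
    by apply: measurable_funD; apply: measurable_funM => //; apply: measurable_funX;
      apply: measurable_funB.
  - exact: (measurable_densE du lik0 mlik).
  - by move=> p _; exact: exp_psi_le.
rewrite (densE_swap df du lik0 mlik).
apply: (@le_trans _ _ (densE u (fun z => w%:E * (G1 z.1 * G2 z.2))%E)).
  apply: le_densE.
  - exact: du.
  - by move=> z; exact: densE_ge0.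
  - exact: (measurable_densE df (fun z p => lik0 p z) mlik').
  - exact: emeasurable_funM.
  - by move=> -[z1 z2] /ditherdens_neq0; exact: densE_lik_le.
rewrite densEZ//; last 3 first.
- exact: du.
- by rewrite ltW// qstep_area_gt0.
- by move=> z; rewrite mule_ge0.
rewrite (dither_mul D1_gt0 D2_gt0)//; [|exact: mG..].
rewrite muleA -EFinM divff ?gt_eqF ?qstep_area_gt0// mul1e.
apply: (@le_trans _ _ (1 * 1)%E); last by rewrite mule1.
apply: lee_pmul.
- by apply: integral_ge0.
- by apply: integral_ge0.
- exact: gauss_grid_le1.
- exact: gauss_grid_le1.
Qed.

End single_letter.

(** * The converse for block codes *)

Lemma sume_const_ord (R : realType) (n : nat) (x : \bar R) :
  (\sum_(i < n) x = (n%:R)%:E * x)%E.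
Proof.
elim: n => [|n IH]; first by rewrite big_ord0 mul0e.
by rewrite big_ord_recr/= IH -natr1 EFinD ge0_muleDl ?lee_fin// mul1e.
Qed.

Section converse.
Variables (R : realType) (A D1 D2 : R) (f : R -> R -> R).
Hypotheses (D1_gt0 : 0 < D1) (D2_gt0 : 0 < D2) (df : density f).
Hypothesis f_supp : forall a b, f a b != 0 -> `|a| <= A /\ `|b| <= A.
Local Notation RR := ((R * R)%type : measurableType _).
Local Notation TT n := ((n.-tuple R * n.-tuple R)%type : measurableType _).

Lemma measurable_enc n M (enc : n.-tuple R -> 'I_M) m :
  (forall m, tuple_measurable (enc @^-1` [set m])) ->
  measurable_fun setT (fun s : n.-tuple R => (enc s == m)%:R : R).
Proof.
move=> menc; rewrite (_ : (fun s => _) = \1_(enc @^-1` [set m])).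
  by apply: measurable_indic; exact: tuple_measurable_sub.
apply/funext => s; rewrite indicE; congr (_%:R); congr nat_of_bool.
by apply/eqP/idP => [h|]; rewrite inE.
Qed.

(** Any function of the two messages is a finite combination of products of cell indicators,
    whatever the decoder. *)
Lemma measurable_encs n M1 M2 (enc1 : n.-tuple R -> 'I_M1) (enc2 : n.-tuple R -> 'I_M2)
    (g : 'I_M1 -> 'I_M2 -> R) :
  (forall m, tuple_measurable (enc1 @^-1` [set m])) ->
  (forall m, tuple_measurable (enc2 @^-1` [set m])) ->
  measurable_fun setT (fun v : TT n => g (enc1 v.1) (enc2 v.2)).
Proof.
move=> m1 m2.
rewrite (_ : (fun v => _) = fun v : TT n => \sum_(m : 'I_M1) \sum_(m' : 'I_M2)
    (g m m' * ((enc1 v.1 == m)%:R * (enc2 v.2 == m')%:R))).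
  apply: measurable_sum => m; apply: measurable_sum => m'.
  apply: measurable_funM => //; apply: measurable_funM.
    exact: (measurableT_comp (measurable_enc m m1)).
  exact: (measurableT_comp (measurable_enc m' m2)).
apply/funext => v; rewrite (bigD1 (enc1 v.1))//= [X in _ + X]big1; last first.
  by move=> i /negbTE ni; apply: big1 => j _; rewrite eq_sym ni mul0r mulr0.
rewrite addr0 (bigD1 (enc2 v.2))//= [X in _ + X]big1; last first.
  by move=> i /negbTE ni; rewrite [_ == i]eq_sym ni !mulr0.
by rewrite !eqxx !mulr1 addr0.
Qed.

Lemma block_measurable_sqdist1 n M1 M2
    (enc1 : n.-tuple R -> 'I_M1) (enc2 : n.-tuple R -> 'I_M2)
    (dec : 'I_M1 -> 'I_M2 -> n.-tuple R * n.-tuple R) :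
  (forall m, tuple_measurable (enc1 @^-1` [set m])) ->
  (forall m, tuple_measurable (enc2 @^-1` [set m])) ->
  block_measurable (fun s t => (sqdist s (dec (enc1 s) (enc2 t)).1)%:E).
Proof.
move=> m1 m2; apply/measurable_EFinP; apply: measurable_sum => i.
apply: measurable_funX; apply: measurable_funB.
  exact: (measurableT_comp (measurable_tnth i)).
exact: (measurable_encs (fun m m' => tnth (dec m m').1 i) m1 m2).
Qed.

Lemma block_measurable_sqdist2 n M1 M2
    (enc1 : n.-tuple R -> 'I_M1) (enc2 : n.-tuple R -> 'I_M2)
    (dec : 'I_M1 -> 'I_M2 -> n.-tuple R * n.-tuple R) :
  (forall m, tuple_measurable (enc1 @^-1` [set m])) ->
  (forall m, tuple_measurable (enc2 @^-1` [set m])) ->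
  block_measurable (fun s t => (sqdist t (dec (enc1 s) (enc2 t)).2)%:E).
Proof.
move=> m1 m2; apply/measurable_EFinP; apply: measurable_sum => i.
apply: measurable_funX; apply: measurable_funB.
  exact: (measurableT_comp (measurable_tnth i)).
exact: (measurable_encs (fun m m' => tnth (dec m m').2 i) m1 m2).
Qed.

Lemma measurable_letter n (g : RR -> R) (i : 'I_n) : measurable_fun setT g ->
  measurable_fun setT (fun v : TT n => g (tnth v.1 i, tnth v.2 i)).
Proof.
move=> mg; apply: (measurableT_comp mg).
by apply: measurable_fun_pair; apply: (measurableT_comp (measurable_tnth i)).
Qed.

Lemma sqdist_ge0 n (s t : n.-tuple R) : 0 <= sqdist s t.
Proof. by apply: sumr_ge0 => i _; exact: sqr_ge0. Qed.

(** * The converse for one fixed code of positive block length *)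

Section code.
Variables (e s1 s2 : R).
Hypotheses (e_gt0 : 0 < e) (s1_gt0 : 0 < s1) (s2_gt0 : 0 < s2).
Variables (n M1 M2 : nat) (enc1 : n.-tuple R -> 'I_M1) (enc2 : n.-tuple R -> 'I_M2).
Variable dec : 'I_M1 -> 'I_M2 -> n.-tuple R * n.-tuple R.
Hypothesis menc1 : forall m, tuple_measurable (enc1 @^-1` [set m]).
Hypothesis menc2 : forall m, tuple_measurable (enc2 @^-1` [set m]).
Hypothesis n_gt0 : (0 < n)%N.
Local Notation kappa := (surprisal D1 D2 f e).
Local Notation Psi := (psi D1 D2 f e s1 s2).
Local Notation C0 := (psi_cst D1 D2 e s1 s2).
Local Notation rate := (ln M1%:R + ln M2%:R : R).

Definition codeword (m : 'I_M1 * 'I_M2) (i : 'I_n) : R * R :=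
  (tnth (dec m.1 m.2).1 i, tnth (dec m.1 m.2).2 i).

Definition wordlik (m : 'I_M1 * 'I_M2) (s t : n.-tuple R) : R :=
  \prod_(i < n) expR (Psi (codeword m i) (tnth s i, tnth t i)).

(** Encoding the zero word exhibits a message, so ['I_M1] and ['I_M2] are inhabited. *)
Lemma code_size_gt0 : (0 < M1)%N /\ (0 < M2)%N.
Proof.
split; first exact: leq_ltn_trans (ltn_ord (enc1 [tuple of nseq n 0])).
exact: leq_ltn_trans (ltn_ord (enc2 [tuple of nseq n 0])).
Qed.

(* The likelihood of the transmitted codeword is one term of the sum, and
   [1 + x <= expR x]. *)
Lemma codeword_bound (s t : n.-tuple R) :
  \sum_(i < n) kappa (tnth s i, tnth t i) + 1 <= rate + n%:R * C0
    + ((2 * s1)^-1 * sqdist s (dec (enc1 s) (enc2 t)).1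
       + ((2 * s2)^-1 * sqdist t (dec (enc1 s) (enc2 t)).2
          + (M1%:R * M2%:R)^-1 * \sum_(m : 'I_M1 * 'I_M2) wordlik m s t)).
Proof.
have [M10 M20] := code_size_gt0.
have M0 : 0 < M1%:R * M2%:R :> R by rewrite mulr_gt0 ?ltr0n.
set m0 := (enc1 s, enc2 t).
pose x := \sum_(i < n) kappa (tnth s i, tnth t i) - n%:R * C0
  - ((2 * s1)^-1 * sqdist s (dec (enc1 s) (enc2 t)).1
  + (2 * s2)^-1 * sqdist t (dec (enc1 s) (enc2 t)).2).
have xE : wordlik m0 s t = expR x.
  rewrite /wordlik -expR_sum; congr expR.
  rewrite /x /sqdist !mulr_sumr -big_split/=.
  rewrite (_ : n%:R * C0 = \sum_(i < n) C0); last first.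
    by rewrite sumr_const card_ord mulr_natl.
  rewrite -!sumrB; apply: eq_bigr => i _.
  by rewrite /psi /cost /codeword/=; ring.
have h1 : expR x <= \sum_(m : 'I_M1 * 'I_M2) wordlik m s t.
  rewrite (bigD1 m0)//= xE lerDl sumr_ge0// => m _.
  by apply: prodr_ge0 => i _; exact: expR_ge0.
(* The tangent is taken at [x - rate] because [expR (- rate)] is the inverse number of codewords,
   the factor that normalizes the sum. *)
have h2 : 1 + (x - rate) <= (M1%:R * M2%:R)^-1 * expR x.
  apply: le_trans (expR_ge1Dx _) _.
  by rewrite expRB expRD !lnK ?posrE ?ltr0n// mulrC.
have h3 : (M1%:R * M2%:R)^-1 * expR x <=
    (M1%:R * M2%:R)^-1 * \sum_(m : 'I_M1 * 'I_M2) wordlik m s t.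
  by rewrite ler_pM2l ?invr_gt0.
by move: h2 h3; rewrite /x; lra.
Qed.

(** The expectation of [codeword_bound]. Every codeword likelihood has mean at most 1, so the
    normalized sum contributes at most 1 and cancels the 1 on the left; dividing by [n] gives the
    claim. *)
Lemma code_converse (d1 d2 : R) :
  ((n%:R^-1)%:E * blockE f (fun x1 x2 =>
     (sqdist x1 (dec (enc1 x1) (enc2 x2)).1)%:E) <= d1%:E)%E ->
  ((n%:R^-1)%:E * blockE f (fun x1 x2 =>
     (sqdist x2 (dec (enc1 x1) (enc2 x2)).2)%:E) <= d2%:E)%E ->
  (densE f (fun p => (kappa p)%:E) <=
    (n%:R^-1 * rate + C0 + d1 / (2 * s1) + d2 / (2 * s2))%:E)%E.
Proof.
have [f0 mf f1] := df.
have [M10 M20] := code_size_gt0.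
have M0 : 0 < M1%:R * M2%:R :> R by rewrite mulr_gt0 ?ltr0n.
have n0 : 0 < n%:R :> R by rewrite ltr0n.
set h1 := (fun x1 x2 => (sqdist x1 _)%:E); set h2 := (fun x1 x2 => (sqdist x2 _)%:E).
have mh1 : block_measurable h1 by exact: block_measurable_sqdist1.
have mh2 : block_measurable h2 by exact: block_measurable_sqdist2.
have h10 s t : (0 <= h1 s t)%E by rewrite lee_fin sqdist_ge0.
have h20 s t : (0 <= h2 s t)%E by rewrite lee_fin sqdist_ge0.
rewrite !lee_pdivrMl// => b1 b2.
have i1 : 0 <= (2 * s1)^-1 by rewrite invr_ge0 mulr_ge0// ltW.
have i2 : 0 <= (2 * s2)^-1 by rewrite invr_ge0 mulr_ge0// ltW.
have iM : 0 <= (M1%:R * M2%:R)^-1 :> R by rewrite invr_ge0 ltW.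
have mk := measurable_surprisal D1_gt0 D2_gt0 df e_gt0.
have k0 := surprisal_ge0 D1_gt0 D2_gt0 df e_gt0.
(* [A0] may be negative; adding [T] to both sides keeps every integrand non-negative. *)
pose A0 := rate + n%:R * C0; pose T := `|A0|.
have T0 : 0 <= T by exact: normr_ge0.
have AT0 : 0 <= A0 + T by rewrite /T -lerBlDl sub0r -normrN ler_norm.
pose K s t : \bar R := (\sum_(i < n) (kappa (tnth s i, tnth t i))%:E)%E.
pose L s t : \bar R := (\sum_(m : 'I_M1 * 'I_M2) (wordlik m s t)%:E)%E.
have mpsi a : measurable_fun setT (fun p : RR => expR (Psi a p)).
  apply: (measurableT_comp (@measurable_expR R)).
  apply: measurable_funB; first by apply: measurable_funB.
  by apply: measurable_funD; apply: measurable_funM => //; apply: measurable_funX;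
    apply: measurable_funB.
have K0 s t : (0 <= K s t)%E by apply: sume_ge0 => i _; rewrite lee_fin.
have w0 m s t : (0 <= (wordlik m s t)%:E)%E.
  by rewrite lee_fin; apply: prodr_ge0 => i _; exact: expR_ge0.
have L0 s t : (0 <= L s t)%E by apply: sume_ge0 => m _.
have mK : block_measurable K.
  apply: block_measurable_sum => i; apply/measurable_EFinP; exact: (measurable_letter i mk).
have mw m : block_measurable (fun s t => (wordlik m s t)%:E).
  apply/measurable_EFinP; apply: measurable_prod => i _.
  exact: (measurable_letter i (mpsi (codeword m i))).
have mL : block_measurable L by exact: block_measurable_sum.
have EL : (blockE f L <= (M1%:R * M2%:R)%:E)%E.
  rewrite /L blockE_sum//.
  apply: (@le_trans _ _ (\sum_(m : 'I_M1 * 'I_M2) 1%:E)%E).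
    apply: lee_sum => m _.
    apply: (blockE_prod_le1 f0 mf (g := fun i p => expR (Psi (codeword m i) p))) => //.
    by move=> i; exact: (exp_psi_le1 D1_gt0 D2_gt0 df f_supp).
  by rewrite sumEFin sumr_const card_prod !card_ord natrM.
have EK : (blockE f K = (n%:R)%:E * densE f (fun p => (kappa p)%:E))%E.
  rewrite /K blockE_sum//; last 2 first.
  - by move=> i s t; rewrite lee_fin.
  - by move=> i; apply/measurable_EFinP; exact: (measurable_letter i mk).
  under eq_bigr => i _ do rewrite (blockE_letter f0 mf f1 i k0 mk).
  exact: sume_const_ord.
have key : (blockE f (fun s t => K s t + (1 + T)%:E) <=
  blockE f (fun s t => (A0 + T)%:E + (((2 * s1)^-1)%:E * h1 s t +
     (((2 * s2)^-1)%:E * h2 s t + ((M1%:R * M2%:R)^-1)%:E * L s t))))%E.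
  apply: blockE_le => //.
  - by move=> s t; apply: adde_ge0 => //; rewrite lee_fin addr_ge0.
  - by apply: block_measurableD => //; exact: block_measurable_cst.
  - apply: block_measurableD; first exact: block_measurable_cst.
    apply: block_measurableD; first exact: block_measurableZ.
    by apply: block_measurableD; exact: block_measurableZ.
  - move=> s t; rewrite /K /L /h1 /h2 !sumEFin -?EFinM -?EFinD lee_fin.
    have := codeword_bound s t; rewrite -/A0; lra.
move: key.
have p1 s t : (0 <= ((2 * s1)^-1)%:E * h1 s t)%E.
  by apply: mule_ge0; [rewrite lee_fin|exact: h10].
have p2 s t : (0 <= ((2 * s2)^-1)%:E * h2 s t)%E.
  by apply: mule_ge0; [rewrite lee_fin|exact: h20].
have p3 s t : (0 <= ((M1%:R * M2%:R)^-1)%:E * L s t)%E.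
  by apply: mule_ge0; [rewrite lee_fin|exact: L0].
have p23 s t : (0 <= ((2 * s2)^-1)%:E * h2 s t + ((M1%:R * M2%:R)^-1)%:E * L s t)%E.
  exact: adde_ge0.
have p123 s t : (0 <= ((2 * s1)^-1)%:E * h1 s t +
    (((2 * s2)^-1)%:E * h2 s t + ((M1%:R * M2%:R)^-1)%:E * L s t))%E.
  exact: adde_ge0.
have q1 := block_measurableZ ((2 * s1)^-1)%:E mh1.
have q2 := block_measurableZ ((2 * s2)^-1)%:E mh2.
have q3 := block_measurableZ ((M1%:R * M2%:R)^-1)%:E mL.
have c1 (c : R) (s t : n.-tuple R) : 0 <= c -> (0 <= c%:E)%E by rewrite lee_fin.
rewrite (blockED f0 mf K0 (fun s t => c1 (1 + T) s t (addr_ge0 ler01 T0)) mK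
  (block_measurable_cst _)).
rewrite (blockE_cst f0 mf f1 n (addr_ge0 ler01 T0)) EK.
rewrite (blockED f0 mf (fun s t => c1 (A0 + T) s t AT0) p123
  (block_measurable_cst _) (block_measurableD q1 (block_measurableD q2 q3))).
rewrite (blockE_cst f0 mf f1 n AT0) (blockED f0 mf p1 p23 q1 (block_measurableD q2 q3)).
rewrite (blockED f0 mf p2 p3 q2 q3) (blockEZ f0 mf i1 h10 mh1) (blockEZ f0 mf i2 h20 mh2).
rewrite (blockEZ f0 mf iM L0 mL) => key.
have key2 : ((n%:R)%:E * densE f (fun p => (kappa p)%:E) + (1 + T)%:E <=
   (A0 + T + ((2 * s1)^-1 * (n%:R * d1) + ((2 * s2)^-1 * (n%:R * d2) + 1)))%:E)%E.
  apply: le_trans key _; rewrite (EFinD (A0 + T)) (EFinD (_^-1 * _)) (EFinD (_^-1 * _)).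
  apply: leeD => //; apply: leeD; last apply: leeD.
  - by rewrite EFinM; apply: lee_wpmul2l; rewrite ?lee_fin.
  - by rewrite EFinM; apply: lee_wpmul2l; rewrite ?lee_fin.
  - by rewrite lee_pdivrMl// mule1.
rewrite -(@lee_pmul2l _ n%:R%:E)//.
rewrite -(@leeD2rE _ (1 + T)%:E)//; apply: le_trans key2 _.
rewrite -EFinM -EFinD lee_fin /A0 le_eqVlt; apply/orP; left; apply/eqP.
by field; rewrite !gt_eqF.
Qed.

End code.
End converse.

(** * The sum-rate bound *)

(** Since [qstep D ^+ 2 = 12 * D], the constant is the differential entropy of a Gaussian of
    variance [d + D] minus the logarithm of the cell length. *)
Lemma cconstE (R : realType) (d D : R) : 0 < D -> 0 <= d ->
  ln 2 * cconst d D = 2^-1 * ln (2 * pi * (d + D)) + 2^-1 - ln (qstep D).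
Proof.
move=> D0 d0; have q0 := qstep_gt0 D0; have p0 := pi_gt0 R.
have l0 : ln 2 != 0 :> R by rewrite gt_eqF// ln2_gt0.
have s0 : 0 < d + D by rewrite ltr_wpDl.
have D12 : 0 < 12 * D by rewrite mulr_gt0.
have -> : ln (qstep D) = 2^-1 * ln (12 * D).
  by rewrite -qstep_sqr// lnXn// -[X in _ = _ * X]mulr_natl mulrA mulVf// mul1r.
rewrite /cconst /log2.
have -> : pi * expR 1 / 6 * (d / D + 1) = (2 * pi * (d + D)) * expR 1 / (12 * D).
  by field; rewrite gt_eqF.
rewrite ln_div ?posrE ?mulr_gt0 ?expR_gt0// lnM ?posrE ?mulr_gt0 ?expR_gt0//.
by rewrite expRK; field.
Qed.

(** A code with slack [delta] has non-negative distortion at most [d_i + delta]. This ensures that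
    the variances [d_i + D_i] chosen below are positive. *)
Lemma in_opregion_ge0 (R : realType) (f : R -> R -> R) (d1 d2 Rs1 Rs2 : R) :
  (forall a b, 0 <= f a b) -> in_opregion f d1 d2 Rs1 Rs2 -> 0 <= d1 /\ 0 <= d2.
Proof.
move=> f0 op.
have gen n (h : n.-tuple R -> n.-tuple R -> R) d : (forall s t, 0 <= h s t) ->
    ((n%:R^-1)%:E * blockE f (fun s t => (h s t)%:E) <= d%:E)%E -> 0 <= d.
  move=> h0; rewrite -lee_fin; apply: le_trans; apply: mule_ge0.
    by rewrite lee_fin invr_ge0.
  by apply: blockE_ge0 => // s t; rewrite lee_fin.
(* [N] may be 0; then [n%:R^-1] is 0 and the argument still applies. *)
split; apply/ler_addgt0Pl => d d0; have [N HN] := op d d0;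
  have [M1 [M2 [enc1 [enc2 [dec [_ [_ [b1 [b2 _]]]]]]]]] := HN N (leqnn N);
  rewrite addrC.
- by apply: gen b1 => s t; exact: sqdist_ge0.
- by apply: gen b2 => s t; exact: sqdist_ge0.
Qed.

Lemma sum_rate_converse (R : realType) (A D1 D2 : R) (f : R -> R -> R)
    (d1 d2 Rs1 Rs2 : R) : 0 < D1 -> 0 < D2 -> density f ->
  (forall a b, f a b != 0 -> `|a| <= A /\ `|b| <= A) ->
  in_opregion f d1 d2 Rs1 Rs2 ->
  (H_Y12_Z f D1 D2 <= (Rs1 + Rs2 + cconst d1 D1 + cconst d2 D2)%:E)%E.
Proof.
move=> D1_gt0 D2_gt0 df f_supp op.
have [d10 d20] : 0 <= d1 /\ 0 <= d2 by apply: in_opregion_ge0 op; case: df.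
(* With these variances the dither and distortion costs add up to [1/2] per coordinate, the constant
   in [cconstE]. *)
pose s1 := d1 + D1; pose s2 := d2 + D2.
have s10 : 0 < s1 by rewrite ltr_wpDl.
have s20 : 0 < s2 by rewrite ltr_wpDl.
have l0 := @ln2_gt0 R.
(* The total coefficient of [e] in the error: 2 for the two rate slacks and, in natural units, 1 for
   [ln (1 + e)], [(2 * s_i)^-1] for each distortion slack, and the grid size for the smoothing. *)
pose C : R := 2 + (ln 2)^-1 * (1 + (2 * s1)^-1 + (2 * s2)^-1 + (size (pgrid A D1 D2))%:R).
have i1 : 0 < (2 * s1)^-1 by rewrite invr_gt0 mulr_gt0.
have i2 : 0 < (2 * s2)^-1 by rewrite invr_gt0 mulr_gt0.
have C0 : 0 < C.
  rewrite addr_gt0// mulr_gt0 ?invr_gt0// ltr_wpDr// addr_gt0// addr_gt0//.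
apply/lee_addgt0Pr => eps eps0.
(* The same [e] is the smoothing parameter and the slack of the code. *)
pose e := eps / C; have e0 : 0 < e by rewrite divr_gt0.
have [N HN] := op e e0.
(* Block length [N.+1] rather than [N], so that it is positive. *)
have [M1 [M2 [enc1 [enc2 [dec [m1 [m2 [b1 [b2 [r1 r2]]]]]]]]]] := HN N.+1 (leqnSn N).
have cc := code_converse D1_gt0 D2_gt0 df f_supp e0 s10 s20 m1 m2 (ltn0Sn N) b1 b2.
have il0 : 0 <= (ln 2)^-1 :> R by rewrite invr_ge0 ltW.
apply: le_trans (entropy_le_surprisal D1_gt0 D2_gt0 df f_supp e0) _.
apply: le_trans (lee_wpmul2l _ (leeD2r _ cc)) _; first by rewrite lee_fin.
rewrite -EFinD -EFinM -EFinD lee_fin ler_pdivrMl//.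
have E1 := cconstE D1_gt0 d10; have E2 := cconstE D2_gt0 d20.
have q1 := qstep_gt0 D1_gt0; have q2 := qstep_gt0 D2_gt0.
have he : ln (1 + e) <= e by apply: le_ln1Dx; rewrite (lt_trans _ e0)// ltrN10.
have epsE : ln 2 * eps = ln 2 * 2 * e +
    (e + e / (2 * s1) + e / (2 * s2) + (size (pgrid A D1 D2))%:R * e).
  rewrite (_ : eps = C * e); last by rewrite /e mulrC divfK// gt_eqF.
  by rewrite /C; field; rewrite !gt_eqF.
have h1 : D1 / (2 * s1) + (d1 + e) / (2 * s1) = 2^-1 + e / (2 * s1).
  by rewrite /s1; field; rewrite gt_eqF.
have h2 : D2 / (2 * s2) + (d2 + e) / (2 * s2) = 2^-1 + e / (2 * s2).
  by rewrite /s2; field; rewrite gt_eqF.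
have k1 : N.+1%:R^-1 * ln M1%:R <= ln 2 * (Rs1 + e).
  by rewrite -ler_pdivrMl// mulrC -mulrA.
have k2 : N.+1%:R^-1 * ln M2%:R <= ln 2 * (Rs2 + e).
  by rewrite -ler_pdivrMl// mulrC -mulrA.
have -> : ln 2 * (Rs1 + Rs2 + cconst d1 D1 + cconst d2 D2 + eps) =
    ln 2 * Rs1 + ln 2 * Rs2 + ln 2 * cconst d1 D1 + ln 2 * cconst d2 D2 + ln 2 * eps by ring.
have lw : ln (qstep D1 * qstep D2) = ln (qstep D1) + ln (qstep D2) by rewrite lnM ?posrE.
rewrite /psi_cst lw E1 E2 epsE -/s1 -/s2 mulrDr.
move: h1 h2 k1 k2; rewrite (mulrDr (ln 2) Rs1) (mulrDr (ln 2) Rs2).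
rewrite -(mulrA (ln 2) 2) (mulrCA (ln 2) 2).
(* Abstracting every nonlinear subterm leaves a problem of linear arithmetic. *)
move: (D1 / _) (D2 / _) ((d1 + e) / _) ((d2 + e) / _) (e / (2 * s1)) (e / (2 * s2))
  (_ * ln M1%:R) (_ * ln M2%:R) (_%:R * e) (ln (qstep D1)) (ln (qstep D2))
  (ln (2 * pi * s1)) (ln (2 * pi * s2)) (ln 2 * e) (ln 2 * Rs1) (ln 2 * Rs2).
by move: he; move: (ln (1 + e)) => *; lra.
Qed.

Theorem theorem3 (R : realType) (A D1 D2 : R) (f : R -> R -> R)
  (hD1 : 0 < D1) (hD2 : 0 < D2)
  (hf0 : forall a b, 0 <= f a b)
  (hfm : measurable_fun [set: R * R] (fun p : R * R => f p.1 p.2))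
  (hsupp : forall a b, f a b != 0 -> `|a| <= A /\ `|b| <= A)
  (hf1 : (\int[@leb2 R]_p (f p.1 p.2)%:E = 1)%E)
  (hmean1 : (\int[@leb2 R]_p (p.1 * f p.1 p.2)%:E = 0)%E)
  (hmean2 : (\int[@leb2 R]_p (p.2 * f p.1 p.2)%:E = 0)%E) :
  let Ds1 := Dstar1 f D1 D2 in
  let Ds2 := Dstar2 f D1 D2 in
  let c1 := cconst Ds1 D1 in
  let c2 := cconst Ds2 D2 in
  (forall Rs1 Rs2 R1 R2 : R,
     in_opregion f Ds1 Ds2 Rs1 Rs2 ->
     inRegion f D1 D2 R1 R2 ->
     inRbar1 f D1 D2 R1 ->
     (R1 + R2)%:E = H_Y12_Z f D1 D2 ->
     R1 + R2 <= Rs1 + Rs2 + c1 + c2) /\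
  (forall Rs1 Rs2 : R,
     in_opregion f Ds1 Ds2 Rs1 Rs2 ->
     inRbar1 f D1 D2 Rs1 ->
     exists R1 R2 : R,
       inRegion f D1 D2 R1 R2 /\ R1 = Rs1 /\ R2 <= Rs2 + c1 + c2).
Proof.
move=> Ds1 Ds2 c1 c2.
have df : density f by split.
split=> [Rs1 Rs2 R1 R2 op _ _ HE|Rs1 Rs2 op [HY1Y2 RY1]].
  by rewrite -lee_fin HE; exact: (sum_rate_converse hD1 hD2 df hsupp op).
have H12 := sum_rate_converse hD1 hD2 df hsupp op.
exists Rs1, (Rs2 + c1 + c2); split; last by split.
split; first exact: HY1Y2.
split; last by move: H12; rewrite -/c1 -/c2 !addrA.
(* Since [Rs1 <= H_Y1_Z1], the chain rule gives [Rs1 + H_Y2_Y1Z <= H_Y12_Z <= Rs1 + R2] with [R2]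
   the chosen witness; the finite [Rs1] cancels. *)
have := chain_rule hD1 hD2 df hsupp; move: H12 => /[swap] <- H12.
rewrite -(@leeD2lE _ Rs1%:E)//; apply: le_trans (leeD2r _ RY1) _.
by rewrite -EFinD; move: H12; rewrite -/c1 -/c2 !addrA.
Qed.
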